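(* Let $b\in H^\infty(\mathbb{D})$ be a non-constant analytic function with $\|b\|_\infty\le 1$. For any $f\in H(b)$, the operator $C_b^*T_f^*$ is bounded on $H^2$ and $\|C_b^*T_f^*\|\le \|f\|_{H(b)}$. (Here $C_b^*T_f^*$ is the linear operator defined on the dense linear span of the Szegő kernels $k_w$, $w\in\mathbb{D}$, by $C_b^*T_f^*k_w=\overline{f(w)}\,k_{b(w)}$; boundedness means that it extends to a bounded linear operator on $H^2$.)
   Context: $\mathbb{D}$ is the open unit disk in $\mathbb{C}$. $H^2=H^2(\mathbb{D})$ is the Hardy space of analytic functions on $\mathbb{D}$ with norm $\|f\|^2=\sup_{0<r<1}\frac1{2\pi}\int_0^{2\pi}|f(re^{i\theta})|^2\,d\theta<\infty$. The Szegő kernel $k_w(z)=k(z,w)=\frac{1}{1-\overline{w}z}$ is its reproducing kernel: $\langle f,k_w\rangle=f(w)$ for all $f\in H^2$, $w\in\mathbb{D}$. $H^\infty(\mathbb{D})$ is the space of bounded analytic functions on $\mathbb{D}$ with the supremum norm. Since $b$ is non-constant with $\|b\|_\infty\le1$, $b$ maps $\mathbb{D}$ into $\mathbb{D}$. The de Branges-Rovnyak space $H(b)$ is the reproducing kernel Hilbert space on $\mathbb{D}$ with kernel $$k^b(z,w)=\frac{1-\overline{b(w)}b(z)}{1-\overline{w}z}.$$ For any function $f:\mathbb{D}\to\mathbb{C}$, $T_f^*$ denotes the densely defined operator on $H^2$ given on Szegő kernels by $T_f^*k_w=\overline{f(w)}k_w$ and extended linearly to their linear span. The operator $C_b^*$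 is defined on the linear span of the Szegő kernels by $C_b^*k_w=k_{b(w)}$ and linear extension. (The adjoint notation is only formal a priori.) *)

(* Defs.v *)
From Stdlib Require Import Reals.
From Coquelicot Require Import Coquelicot.

Open Scope R_scope.

Definition disk : Type := {z : C | Cmod z < 1}.

Definition disk_val (z : disk) : C := proj1_sig z.
Coercion disk_val : disk >-> C.

(** Extension by zero.  As the disk is open, the value chosen outside it plays
    no role in differentiability at points of the disk. *)
Definition extend (f : disk -> C) (z : C) : C :=
  match Rlt_dec (Cmod z) 1 with
  | left hz => f (exist _ z hz)
  | right _ => RtoC 0
  end.

Definition analytic (f : disk -> C) : Prop :=
  forall z : disk, @ex_derive C_AbsRing C_NormedModule (extend f) (z : C).

Definition fzero {X : Type} : X -> C := fun _ => RtoC 0.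
Definition fadd {X : Type} (f g : X -> C) : X -> C := fun x => Cplus (f x) (g x).
Definition fscal {X : Type} (a : C) (f : X -> C) : X -> C :=
  fun x => Cmult a (f x).
Definition fsub {X : Type} (f g : X -> C) : X -> C := fun x => Cminus (f x) (g x).

Definition sup_norm (f : disk -> C) : Rbar :=
  Lub_Rbar (fun y => exists z : disk, y = Cmod (f z)).

Definition Hinf (f : disk -> C) : Prop := analytic f /\ is_finite (sup_norm f).

Definition circle_pt (r t : R) : C := (r * cos t, r * sin t).

Definition circle_mean (f : disk -> C) (r : R) : R :=
  / (2 * PI) * RInt (fun t => (Cmod (extend f (circle_pt r t))) ^ 2) 0 (2 * PI).

Definition H2_norm_sq (f : disk -> C) : Rbar :=
  Lub_Rbar (fun y => exists r : R, 0 < r < 1 /\ y = circle_mean f r).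

Definition H2 (f : disk -> C) : Prop := analytic f /\ is_finite (H2_norm_sq f).

(** Meaningful on [H2] only: [real] sends an infinite supremum to 0. *)
Definition H2_norm (f : disk -> C) : R := sqrt (real (H2_norm_sq f)).

(** The parameter is a complex number rather than a point of [disk] so that
    [szego (b w)] can be written for a symbol [b : disk -> C]; the denominator
    does not vanish as soon as [Cmod w <= 1]. *)
Definition szego (w : C) : disk -> C :=
  fun z => Cdiv (RtoC 1) (Cminus (RtoC 1) (Cmult (Cconj w) z)).

(** Operators on [H2] are represented by maps on all functions, of which only
    the restriction to [H2] matters. *)
Record H2_bounded_operator (T : (disk -> C) -> (disk -> C)) : Prop := {
  H2op_maps : forall g, H2 g -> H2 (T g);
  H2op_add : forall g h, H2 g -> H2 h ->
    forall z, T (fadd g h) z = fadd (T g) (T h) z;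
  H2op_scal : forall a g, H2 g -> forall z, T (fscal a g) z = fscal a (T g) z;
  H2op_bound : exists M : R, forall g, H2 g -> H2_norm (T g) <= M * H2_norm g
}.

Definition H2_op_norm (T : (disk -> C) -> (disk -> C)) : Rbar :=
  Lub_Rbar (fun y => exists g, H2 g /\ H2_norm g <= 1 /\ y = H2_norm (T g)).

(** [hfs_inner] is linear in its first argument; it is only meaningful on
    [hfs_mem]. *)
Record hilbert_function_space (X : Type) : Type := {
  hfs_mem : (X -> C) -> Prop;
  hfs_inner : (X -> C) -> (X -> C) -> C;
  hfs_mem_zero : hfs_mem fzero;
  hfs_mem_add : forall f g, hfs_mem f -> hfs_mem g -> hfs_mem (fadd f g);
  hfs_mem_scal : forall a f, hfs_mem f -> hfs_mem (fscal a f);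
  hfs_inner_add : forall f g h, hfs_mem f -> hfs_mem g -> hfs_mem h ->
    hfs_inner (fadd f g) h = Cplus (hfs_inner f h) (hfs_inner g h);
  hfs_inner_scal : forall a f h, hfs_mem f -> hfs_mem h ->
    hfs_inner (fscal a f) h = Cmult a (hfs_inner f h);
  hfs_inner_conj : forall f g, hfs_mem f -> hfs_mem g ->
    hfs_inner g f = Cconj (hfs_inner f g);
  hfs_inner_pos : forall f, hfs_mem f -> 0 <= Re (hfs_inner f f);
  hfs_inner_def : forall f, hfs_mem f -> hfs_inner f f = RtoC 0 ->
    forall x, f x = RtoC 0;
  hfs_complete : forall u : nat -> X -> C, (forall n, hfs_mem (u n)) ->
    (forall eps : R, 0 < eps -> exists N : nat, forall n m : nat,
       (N <= n)%nat -> (N <= m)%nat ->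
       sqrt (Re (hfs_inner (fsub (u n) (u m)) (fsub (u n) (u m)))) < eps) ->
    exists g, hfs_mem g /\
      forall eps : R, 0 < eps -> exists N : nat, forall n : nat, (N <= n)%nat ->
        sqrt (Re (hfs_inner (fsub (u n) g) (fsub (u n) g))) < eps
}.

Arguments hfs_mem {X} _ _.
Arguments hfs_inner {X} _ _ _.

Definition hfs_norm {X : Type} (H : hilbert_function_space X) (f : X -> C) : R :=
  sqrt (Re (hfs_inner H f f)).

(** By the Moore-Aronszajn theorem, the space [H] (with its inner product) is
    determined by its kernel [k]. *)
Definition reproducing_kernel {X : Type} (H : hilbert_function_space X)
    (k : X -> X -> C) : Prop :=
  (forall w, hfs_mem H (fun z => k z w)) /\
  (forall f w, hfs_mem H f -> hfs_inner H f (fun z => k z w) = f w).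

Definition dBR_kernel (b : disk -> C) (z w : disk) : C :=
  Cdiv (Cminus (RtoC 1) (Cmult (Cconj (b w)) (b z)))
       (Cminus (RtoC 1) (Cmult (Cconj w) z)).

Definition is_de_Branges_Rovnyak (b : disk -> C)
    (H : hilbert_function_space disk) : Prop :=
  reproducing_kernel H (dBR_kernel b).

(* Main.v *)
Require Import Defs.
From Stdlib Require Import Reals Arith Lra Lia List ClassicalEpsilon.
From Stdlib Require Import FunctionalExtensionality.
From Coquelicot Require Import Coquelicot.
Open Scope R_scope.

(** Why the theorem is true.  Write [k_w] for the Szego kernel and [k^b_w] for the
    kernel of the de Branges-Rovnyak space, so that, since [|b| < 1],

      [k_w(z) = k^b(z, w) / (1 - conj (b w) b(z)) = sum_n b(z)^n k^b(z, w) conj (b w)^n].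

    This says that [V : k_w |-> (conj (b w)^n k^b_w)_n] is an isometry from the Hardy
    space into a direct sum of copies of the de Branges-Rovnyak space.  The map
    [(h_n)_n |-> sum_n <h_n, f> z^n] from this direct sum to the Hardy space has norm at
    most [|f|] by the Cauchy-Schwarz inequality in each copy, and it sends [V k_w] to
    [conj (f w) sum_n conj (b w)^n z^n = conj (f w) k_(b w)].  Hence the operator of the
    theorem is a composition of a contraction and a map of norm at most [|f|].

    On finite combinations of kernels the argument is algebraic.  Both the Hardy norm
    of a combination and the norm of its image under [V] are compared with the same
    Gram form [gram]: [gram_partial_sum] removes Taylor coefficients from it and
    [gram_dBR_partial_sum] removes components of [V].  The resulting estimate is
    [kcoef_bound].  That [|b| < 1] on the disk is also read off from the kernel: a value
    of modulus one gives a null kernel vector ([dBR_symbol_lt_1]).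

    It remains to extend the operator from the span of the kernels to the whole Hardy
    space, which is done on coefficient sequences.  The kernels span a dense subspace of
    little l-two ([l2_approximable]), so the closure of the graph is the graph of a
    bounded operator ([image_exists], [image_le], [image_unique]).  The passage
    between Hardy functions and square-summable sequences has two halves.  A power
    series with square-summable coefficients is analytic and its circular means are
    bounded by the norm of the coefficients ([psum_cdiff], [mean_psum_le]).
    Conversely a Hardy function has square-summable Taylor coefficients ([taylor_l2_le]):
    this is the Bessel inequality on each circle, once the Fourier coefficients on
    circles of different radii are known to be compatible ([fcoef_on_circle]).  As
    analyticity means differentiability at every point, this compatibility rests on
    Goursat's theorem, proved here for closed differential forms on rectangles
    ([bdry_zero]) and applied in the coordinates [z = e^(s+it)]. *)

(** * Finite sums, limits and square-summable sequences *)

Fixpoint rsum (u : nat -> R) (n : nat) : R :=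
  match n with O => 0 | S m => rsum u m + u m end.

Fixpoint csum (u : nat -> C) (n : nat) : C :=
  match n with O => RtoC 0 | S m => Cplus (csum u m) (u m) end.

Definition clim (u : nat -> C) (l : C) : Prop :=
  is_lim_seq (fun n => Cmod (u n - l)%C) 0.

Lemma C_ext (a c : C) : Re a = Re c -> Im a = Im c -> a = c.
Proof. destruct a, c; simpl; congruence. Qed.

Lemma Im_le_Cmod (c : C) : Rabs (Im c) <= Cmod c.
Proof. apply Rle_trans with (2 := Rmax_Cmod c). apply Rmax_r. Qed.

Lemma Cmod_minus_sym (a c : C) : Cmod (a - c)%C = Cmod (c - a)%C.
Proof. replace (a - c)%C with (- (c - a))%C by ring. apply Cmod_opp. Qed.

Lemma Cmod_minus_triangle (a c d : C) :
  Cmod (a - d)%C <= Cmod (a - c)%C + Cmod (c - d)%C.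
Proof.
  replace (a - d)%C with ((a - c) + (c - d))%C by ring. apply Cmod_triangle.
Qed.

Lemma Cmod_le_abs (c : C) : Cmod c <= Rabs (Re c) + Rabs (Im c).
Proof.
  replace c with (RtoC (Re c) + Ci * RtoC (Im c))%C at 1
    by (apply C_ext; simpl; ring).
  apply Rle_trans with (1 := Cmod_triangle _ _).
  rewrite Cmod_mult, Cmod_Ci, !Cmod_R. lra.
Qed.

Lemma is_lim_seq_zero_le (u v : nat -> R) :
  (forall n, 0 <= u n <= v n) -> is_lim_seq v 0 -> is_lim_seq u 0.
Proof.
  intros H Hv. apply is_lim_seq_le_le with (fun _ => 0) v; auto.
  apply is_lim_seq_const.
Qed.

Lemma clim_ext (u v : nat -> C) (l : C) :
  (forall n, u n = v n) -> clim u l -> clim v l.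
Proof.
  intros H. apply is_lim_seq_ext. intros n; now rewrite H.
Qed.

Lemma clim_const (c : C) : clim (fun _ => c) c.
Proof.
  apply is_lim_seq_ext with (fun _ => 0).
  - intros _. replace (c - c)%C with (RtoC 0) by ring. now rewrite Cmod_0.
  - apply is_lim_seq_const.
Qed.

Lemma clim_plus (u v : nat -> C) (l m : C) :
  clim u l -> clim v m -> clim (fun n => u n + v n)%C (l + m)%C.
Proof.
  intros Hu Hv.
  apply is_lim_seq_zero_le with (fun n => Cmod (u n - l)%C + Cmod (v n - m)%C).
  - intros n; split. apply Cmod_ge_0.
    replace (u n + v n - (l + m))%C with ((u n - l) + (v n - m))%C by ring.
    apply Cmod_triangle.
  - replace (Finite 0) with (Finite (0 + 0)) by (f_equal; ring).
    now apply is_lim_seq_plus'.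
Qed.

Lemma clim_scal (a : C) (u : nat -> C) (l : C) :
  clim u l -> clim (fun n => a * u n)%C (a * l)%C.
Proof.
  intros Hu.
  apply is_lim_seq_ext with (fun n => Cmod a * Cmod (u n - l)%C).
  - intros n. rewrite <- Cmod_mult. f_equal. ring.
  - replace (Finite 0) with (Rbar_mult (Cmod a) 0) by (simpl; f_equal; ring).
    now apply is_lim_seq_scal_l.
Qed.

Lemma clim_le (u : nat -> C) (l : C) (K : R) (N : nat) :
  clim u l -> (forall n, (N <= n)%nat -> Cmod (u n) <= K) -> Cmod l <= K.
Proof.
  intros Hu H.
  assert (HH : Rbar_le (Cmod l) (K + 0)).
  { apply is_lim_seq_le_loc with (fun _ => Cmod l) (fun n => K + Cmod (u n - l)%C).
    - exists N; intros n Hn. specialize (H n Hn).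
      replace l with (u n - (u n - l))%C at 1 by ring.
      apply Rle_trans with (1 := Cmod_triangle _ _). rewrite Cmod_opp. lra.
    - apply is_lim_seq_const.
    - apply is_lim_seq_plus'; [apply is_lim_seq_const | exact Hu]. }
  simpl in HH. lra.
Qed.

Lemma clim_unique (u : nat -> C) (l m : C) : clim u l -> clim u m -> l = m.
Proof.
  intros Hl Hm.
  assert (H : clim (fun n => u n + (-1) * u n)%C (l + (-1) * m)%C).
  { apply clim_plus; [exact Hl | now apply clim_scal]. }
  assert (Cmod (l + (-1) * m)%C <= 0).
  { apply clim_le with (2 := fun n (_ : (0 <= n)%nat) =>
      Req_le _ _ (eq_trans (f_equal Cmod (ltac:(ring) :
        (u n + (-1) * u n)%C = RtoC 0)) Cmod_0)). exact H. }
  assert (HC : (l + (-1) * m)%C = RtoC 0).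
  { apply Cmod_eq_0. pose proof (Cmod_ge_0 (l + (-1) * m)%C). lra. }
  replace l with (l + (-1) * m + m)%C by ring. rewrite HC. ring.
Qed.

Lemma clim_cauchy (u : nat -> C) (e : nat -> R) :
  is_lim_seq e 0 ->
  (forall n m, (n <= m)%nat -> Cmod (u m - u n)%C <= e n) ->
  exists l, clim u l.
Proof.
  intros He H.
  assert (HC : forall part : C -> R, (forall c, Rabs (part c) <= Cmod c) ->
    (forall a c, part (a - c)%C = part a - part c) ->
    exists l : R, is_lim_seq (fun n => part (u n)) l).
  { intros part Hp Hm.
    destruct (proj2 (ex_lim_seq_cauchy_corr (fun n => part (u n)))) as [l Hl].
    - intros eps.
      apply is_lim_seq_spec in He. simpl in He.
      destruct (He (pos_div_2 eps)) as [N HN]. exists N. intros n m Hn Hm'.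
      assert (HN0 : Rabs (e N - 0) < eps / 2) by (apply HN; auto).
      apply Rabs_def2 in HN0.
      apply Rle_lt_trans with (Cmod (u n - u m)%C).
      + rewrite <- Hm. apply Hp.
      + apply Rle_lt_trans with (1 := Cmod_minus_triangle _ (u N) _).
        rewrite (Cmod_minus_sym (u N)).
        pose proof (H N n Hn). pose proof (H N m Hm'). lra.
    - now exists l. }
  destruct (HC Re re_le_Cmod) as [p Hp]. { reflexivity. }
  destruct (HC Im Im_le_Cmod) as [q Hq]. { reflexivity. }
  exists (p, q).
  apply is_lim_seq_zero_le with (fun n => Rabs (Re (u n) - p) + Rabs (Im (u n) - q)).
  - intros n; split. apply Cmod_ge_0.
    apply Rle_trans with (1 := Cmod_le_abs _). simpl. apply Req_le. reflexivity.
  - replace (Finite 0) with (Finite (Rabs 0 + Rabs 0)) by (rewrite Rabs_R0; f_equal; ring).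
    apply is_lim_seq_plus'; apply (is_lim_seq_abs _ (Finite 0)).
    + replace (Finite 0) with (Finite (p - p)) by (f_equal; ring).
      apply is_lim_seq_minus'; [exact Hp | apply is_lim_seq_const].
    + replace (Finite 0) with (Finite (q - q)) by (f_equal; ring).
      apply is_lim_seq_minus'; [exact Hq | apply is_lim_seq_const].
Qed.

Lemma clim_Re (u : nat -> C) (l : C) : clim u l -> is_lim_seq (fun n => Re (u n)) (Re l).
Proof.
  intros H. apply is_lim_seq_ext with (fun n => Re (u n - l)%C + Re l).
  { intros n; unfold Re; simpl; ring. }
  replace (Finite (Re l)) with (Finite (0 + Re l)) by (f_equal; ring).
  apply is_lim_seq_plus'; [| apply is_lim_seq_const].
  apply is_lim_seq_abs_0.
  apply is_lim_seq_zero_le with (2 := H).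
  intros n; split. apply Rabs_pos. apply re_le_Cmod.
Qed.

Lemma rsum_ext (u v : nat -> R) (n : nat) :
  (forall k, (k < n)%nat -> u k = v k) -> rsum u n = rsum v n.
Proof.
  induction n; simpl; intros H; auto. rewrite IHn, H; auto.
Qed.

Lemma rsum_le (u v : nat -> R) (n : nat) :
  (forall k, (k < n)%nat -> u k <= v k) -> rsum u n <= rsum v n.
Proof.
  induction n; simpl; intros H; [lra|].
  apply Rplus_le_compat; auto.
Qed.

Lemma rsum_scal (a : R) (u : nat -> R) (n : nat) :
  rsum (fun k => a * u k) n = a * rsum u n.
Proof. induction n; simpl; [ring | rewrite IHn; ring]. Qed.

Lemma rsum_plus (u v : nat -> R) (n : nat) :
  rsum (fun k => u k + v k) n = rsum u n + rsum v n.
Proof. induction n; simpl; [ring | rewrite IHn; ring]. Qed.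

Lemma rsum_nonneg (u : nat -> R) (n : nat) : (forall k, 0 <= u k) -> 0 <= rsum u n.
Proof. intros H; induction n; simpl; [lra | specialize (H n); lra]. Qed.

Lemma rsum_zero (u : nat -> R) (n : nat) :
  (forall k, (k < n)%nat -> u k = 0) -> rsum u n = 0.
Proof. induction n; simpl; intros H; auto. rewrite IHn, H; auto; ring. Qed.

Lemma rsum_shift (u : nat -> R) (n : nat) :
  rsum u (S n) = u O + rsum (fun k => u (S k)) n.
Proof. induction n; simpl in *; [ring | rewrite IHn; ring]. Qed.

Lemma rsum_mono (u : nat -> R) (n m : nat) :
  (forall k, 0 <= u k) -> (n <= m)%nat -> rsum u n <= rsum u m.
Proof.
  intros H Hnm; induction Hnm; simpl; [lra | specialize (H m); lra].
Qed.

Lemma rsum_term_le (u : nat -> R) (n : nat) :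
  (forall k, 0 <= u k) -> u n <= rsum u (S n).
Proof. intros H; simpl. pose proof (rsum_nonneg u n H). lra. Qed.

Lemma csum_ext (u v : nat -> C) (n : nat) :
  (forall k, (k < n)%nat -> u k = v k) -> csum u n = csum v n.
Proof. induction n; simpl; intros H; auto. rewrite IHn, H; auto. Qed.

Lemma csum_plus (u v : nat -> C) (n : nat) :
  csum (fun k => u k + v k)%C n = (csum u n + csum v n)%C.
Proof. induction n; simpl; [ring | rewrite IHn; ring]. Qed.

Lemma csum_scal (a : C) (u : nat -> C) (n : nat) :
  csum (fun k => a * u k)%C n = (a * csum u n)%C.
Proof. induction n; simpl; [ring | rewrite IHn; ring]. Qed.

Lemma Cmod_csum_le (u : nat -> C) (n : nat) :
  Cmod (csum u n) <= rsum (fun k => Cmod (u k)) n.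
Proof.
  induction n; simpl. rewrite Cmod_0; lra.
  apply Rle_trans with (1 := Cmod_triangle _ _). lra.
Qed.

Lemma csum_diff_le (u : nat -> C) (n m : nat) : (n <= m)%nat ->
  Cmod (csum u m - csum u n)%C
    <= rsum (fun k => Cmod (u k)) m - rsum (fun k => Cmod (u k)) n.
Proof.
  intros H; induction H; simpl.
  - replace (csum u n - csum u n)%C with (RtoC 0) by ring. rewrite Cmod_0; lra.
  - replace (csum u m + u m - csum u n)%C with ((csum u m - csum u n) + u m)%C by ring.
    apply Rle_trans with (1 := Cmod_triangle _ _). lra.
Qed.

Lemma rsum_tail_to_0 (u : nat -> R) (K : R) :
  (forall k, 0 <= u k) -> (forall n, rsum u n <= K) ->
  exists l, (forall n, rsum u n <= l) /\ is_lim_seq (fun n => l - rsum u n) 0.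
Proof.
  intros Hpos HK.
  destruct (ex_finite_lim_seq_incr (rsum u) K) as [l Hl]; auto.
  { intros n; simpl; specialize (Hpos n); lra. }
  exists l; split.
  - apply is_lim_seq_incr_compare; auto. intros n; simpl; specialize (Hpos n); lra.
  - replace (Finite 0) with (Finite (l - l)) by (f_equal; ring).
    apply is_lim_seq_minus'; [apply is_lim_seq_const | exact Hl].
Qed.

Lemma csum_abs_cv (u : nat -> C) (K : R) :
  (forall n, rsum (fun k => Cmod (u k)) n <= K) -> exists l, clim (csum u) l.
Proof.
  intros HK.
  destruct (rsum_tail_to_0 (fun k => Cmod (u k)) K) as [l [Hle Hl]]; auto.
  { intros; apply Cmod_ge_0. }
  apply clim_cauchy with (1 := Hl). intros n m Hnm.
  apply Rle_trans with (1 := csum_diff_le u n m Hnm). specialize (Hle m). lra.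
Qed.

(** The ball of radius [A] of little l-two.  Bounding all partial sums avoids
    naming the norm as the sum of a series, and passes to limits at once. *)
Definition l2_le (x : nat -> C) (A : R) : Prop :=
  0 <= A /\ forall n, rsum (fun k => Cmod (x k) ^ 2) n <= A ^ 2.

Lemma l2_le_ext (x y : nat -> C) (A : R) :
  (forall n, x n = y n) -> l2_le x A -> l2_le y A.
Proof.
  intros H [HA Hx]; split; auto. intros n.
  rewrite (rsum_ext _ (fun k => Cmod (x k) ^ 2)); auto. intros; now rewrite H.
Qed.

Lemma l2_le_zero (x : nat -> C) (A : R) : (forall n, x n = RtoC 0) -> 0 <= A -> l2_le x A.
Proof.
  intros E HA. split; auto. intros n. rewrite rsum_zero; [apply pow2_ge_0|].
  intros k _. rewrite E, Cmod_0. ring.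
Qed.

Lemma l2_le_term (x : nat -> C) (A : R) (n : nat) : l2_le x A -> Cmod (x n) <= A.
Proof.
  intros [HA Hx]. apply Rsqr_incr_0_var; auto. rewrite !Rsqr_pow2.
  apply Rle_trans with (2 := Hx (S n)).
  apply (rsum_term_le (fun k => Cmod (x k) ^ 2)). intros; apply pow2_ge_0.
Qed.

Lemma l2_le_weaken (x : nat -> C) (A B : R) : l2_le x A -> A <= B -> l2_le x B.
Proof.
  intros [HA Hx] HAB; split; [lra|]. intros n. apply Rle_trans with (1 := Hx n). nra.
Qed.

Lemma l2_le_scal (a : C) (x : nat -> C) (A : R) :
  l2_le x A -> l2_le (fun n => a * x n)%C (Cmod a * A).
Proof.
  intros [HA Hx]. pose proof (Cmod_ge_0 a). split; [nra|]. intros n.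
  rewrite (rsum_ext _ (fun k => Cmod a ^ 2 * Cmod (x k) ^ 2)).
  - rewrite rsum_scal. specialize (Hx n). pose proof (pow2_ge_0 (Cmod a)). nra.
  - intros; rewrite Cmod_mult; ring.
Qed.

(** Minkowski's inequality.  Weighting [|x+y|^2] by the ratio of the two bounds
    gives the sharp constant without the Cauchy-Schwarz inequality. *)
Lemma l2_le_plus (x y : nat -> C) (A B : R) :
  l2_le x A -> l2_le y B -> l2_le (fun n => x n + y n)%C (A + B).
Proof.
  intros Hx Hy.
  assert (Hz : forall (u v : nat -> C) D, l2_le u 0 -> l2_le v D ->
            l2_le (fun n => u n + v n)%C D).
  { intros u v D Hu Hv. apply l2_le_ext with (2 := Hv). intros n.
    rewrite (Cmod_eq_0 (u n)); [ring|].
    pose proof (l2_le_term u 0 n Hu). pose proof (Cmod_ge_0 (u n)). lra. }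
  destruct (Req_dec A 0) as [->|HA].
  { rewrite Rplus_0_l. now apply Hz. }
  destruct (Req_dec B 0) as [->|HB].
  { rewrite Rplus_0_r. apply l2_le_ext with (fun n => y n + x n)%C.
    intros; ring. now apply Hz. }
  destruct Hx as [HA0 Hx], Hy as [HB0 Hy]. split; [lra|]. intros n.
  apply Rle_trans with
    (rsum (fun k => (1 + B / A) * Cmod (x k) ^ 2 + (1 + A / B) * Cmod (y k) ^ 2) n).
  - apply rsum_le. intros k _.
    pose proof (Cmod_triangle (x k) (y k)).
    pose proof (Cmod_ge_0 (x k)). pose proof (Cmod_ge_0 (y k)).
    pose proof (Cmod_ge_0 (x k + y k)%C).
    apply Rle_trans with ((Cmod (x k) + Cmod (y k)) ^ 2). nra.
    replace ((1 + B / A) * Cmod (x k) ^ 2 + (1 + A / B) * Cmod (y k) ^ 2)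
      with ((Cmod (x k) + Cmod (y k)) ^ 2
            + (B * Cmod (x k) - A * Cmod (y k)) ^ 2 / (A * B)) by (field; lra).
    assert (0 <= (B * Cmod (x k) - A * Cmod (y k)) ^ 2 / (A * B)); [|lra].
    apply Rdiv_le_0_compat; [apply pow2_ge_0 | nra].
  - rewrite rsum_plus, !rsum_scal.
    replace ((A + B) ^ 2) with ((1 + B / A) * A ^ 2 + (1 + A / B) * B ^ 2) by (field; lra).
    assert (0 < B / A) by (apply Rdiv_lt_0_compat; lra).
    assert (0 < A / B) by (apply Rdiv_lt_0_compat; lra).
    specialize (Hx n); specialize (Hy n).
    apply Rplus_le_compat; apply Rmult_le_compat_l; lra.
Qed.

Lemma l2_le_minus (x y : nat -> C) (A B : R) :
  l2_le x A -> l2_le y B -> l2_le (fun n => x n - y n)%C (A + B).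
Proof.
  intros Hx Hy. apply l2_le_ext with (fun n => x n + (-1) * y n)%C.
  { intros; ring. }
  apply l2_le_plus; auto.
  replace B with (Cmod (-1)%C * B). now apply l2_le_scal.
  rewrite Cmod_R, Rabs_left; lra.
Qed.

Lemma Cmod_clim (u : nat -> C) (l : C) :
  clim u l -> is_lim_seq (fun n => Cmod (u n)) (Cmod l).
Proof.
  intros H.
  apply is_lim_seq_le_le with (fun n => Cmod l - Cmod (u n - l)%C)
                              (fun n => Cmod l + Cmod (u n - l)%C).
  - intros n.
    pose proof (Cmod_triangle (u n - l) l) as H1.
    replace (u n - l + l)%C with (u n) in H1 by ring.
    pose proof (Cmod_triangle (l - u n) (u n)) as H2.
    replace (l - u n + u n)%C with l in H2 by ring.
    rewrite (Cmod_minus_sym l) in H2. lra.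
  - replace (Finite (Cmod l)) with (Finite (Cmod l - 0)) by (f_equal; ring).
    apply is_lim_seq_minus'; [apply is_lim_seq_const | exact H].
  - replace (Finite (Cmod l)) with (Finite (Cmod l + 0)) by (f_equal; ring).
    apply is_lim_seq_plus'; [apply is_lim_seq_const | exact H].
Qed.

(** Each partial sum involves finitely many coordinates, so the bounds pass to the
    limit one by one. *)
Lemma l2_le_clim (x : nat -> nat -> C) (y : nat -> C) (A : R) (m0 : nat) :
  (forall n, clim (fun m => x m n) (y n)) ->
  (forall m, (m0 <= m)%nat -> l2_le (x m) A) -> l2_le y A.
Proof.
  intros Hl Hx. split. { apply (Hx m0); auto. }
  intros n.
  assert (HL : is_lim_seq (fun m => rsum (fun k => Cmod (x m k) ^ 2) n)
                          (rsum (fun k => Cmod (y k) ^ 2) n)).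
  { induction n; simpl. apply is_lim_seq_const.
    apply is_lim_seq_plus'; auto.
    pose proof (Cmod_clim _ _ (Hl n)) as Hn.
    apply is_lim_seq_mult'; auto. apply is_lim_seq_mult'; auto. apply is_lim_seq_const. }
  assert (HH : Rbar_le (rsum (fun k => Cmod (y k) ^ 2) n) (A ^ 2)).
  { apply is_lim_seq_le_loc with (2 := HL) (v := fun _ => A ^ 2).
    - exists m0; intros m Hm; now apply Hx.
    - apply is_lim_seq_const. }
  exact HH.
Qed.

Lemma is_lim_seq_inv_S : is_lim_seq (fun n => / (INR n + 1)) 0.
Proof.
  apply is_lim_seq_ext with (fun n => / INR (S n)).
  { intros n; now rewrite S_INR. }
  apply (is_lim_seq_incr_1 (fun n => / INR n)).
  replace (Finite 0) with (Rbar_inv p_infty) by reflexivity.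
  apply is_lim_seq_inv; [apply is_lim_seq_INR | discriminate].
Qed.

Lemma inv_S_pos (n : nat) : 0 < / (INR n + 1).
Proof. apply Rinv_0_lt_compat. pose proof (pos_INR n). lra. Qed.

Lemma inv_S_le (n m : nat) : (n <= m)%nat -> / (INR m + 1) <= / (INR n + 1).
Proof.
  intros H. apply Rinv_le_contravar. pose proof (pos_INR n); lra.
  apply le_INR in H. lra.
Qed.

Lemma l2_le_closed (x : nat -> C) (A : R) : 0 <= A ->
  (forall eps, 0 < eps -> l2_le x (A + eps)) -> l2_le x A.
Proof.
  intros HA H. split; auto. intros n.
  assert (HH : Rbar_le (rsum (fun k => Cmod (x k) ^ 2) n) ((A + 0) * (A + 0))).
  { apply is_lim_seq_le with (fun _ => rsum (fun k => Cmod (x k) ^ 2) n)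
      (fun m => (A + / (INR m + 1)) * (A + / (INR m + 1))).
    - intros m. destruct (H _ (inv_S_pos m)) as [_ Hm].
      apply Rle_trans with (1 := Hm n). right; ring.
    - apply is_lim_seq_const.
    - apply is_lim_seq_mult'; apply is_lim_seq_plus';
        (apply is_lim_seq_const || apply is_lim_seq_inv_S). }
  apply Rle_trans with (1 := HH). right; ring.
Qed.

(** * Finite combinations of kernels and their Gram form *)

(** The pair [(c, w)] stands for the term [c k_w] of a finite combination of
    kernels; the same list is read with the Szego kernel, with its images, and with
    the de Branges-Rovnyak kernel. *)
Definition comb : Type := list (C * disk).

Fixpoint lsum (g : C * disk -> C) (L : comb) : C :=
  match L with nil => RtoC 0 | p :: M => Cplus (g p) (lsum g M) end.

Lemma lsum_ext (g h : C * disk -> C) (L : comb) :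
  (forall p, g p = h p) -> lsum g L = lsum h L.
Proof. intros H; induction L; simpl; auto. now rewrite H, IHL. Qed.

Lemma lsum_plus (g h : C * disk -> C) (L : comb) :
  lsum (fun p => g p + h p)%C L = (lsum g L + lsum h L)%C.
Proof. induction L; simpl; [ring | rewrite IHL; ring]. Qed.

Lemma lsum_scal (a : C) (g : C * disk -> C) (L : comb) :
  lsum (fun p => a * g p)%C L = (a * lsum g L)%C.
Proof. induction L; simpl; [ring | rewrite IHL; ring]. Qed.

Lemma lsum_conj (g : C * disk -> C) (L : comb) :
  Cconj (lsum g L) = lsum (fun p => Cconj (g p)) L.
Proof.
  induction L; simpl. apply C_ext; simpl; ring.
  now rewrite Cplus_conj, IHL.
Qed.

Lemma lsum_app (g : C * disk -> C) (L M : comb) :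
  lsum g (L ++ M) = (lsum g L + lsum g M)%C.
Proof. induction L; simpl; [ring | rewrite IHL; ring]. Qed.

Lemma lsum_map (g : C * disk -> C) (h : C * disk -> C * disk) (L : comb) :
  lsum g (map h L) = lsum (fun p => g (h p)) L.
Proof. induction L; simpl; auto. now rewrite IHL. Qed.

Lemma lsum_clim (g : nat -> C * disk -> C) (h : C * disk -> C) (L : comb) :
  (forall p, clim (fun n => g n p) (h p)) ->
  clim (fun n => lsum (g n) L) (lsum h L).
Proof.
  intros H; induction L; simpl. apply clim_const. now apply clim_plus.
Qed.

(** The adjoint of multiplication by [mu], acting on a combination of kernels. *)
Definition reweight (mu : disk -> C) (L : comb) : comb :=
  map (fun p => (fst p * Cconj (mu (snd p)), snd p)%C) L.

(** The Taylor coefficients of the image of a combination of Szego kernels under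
    [k_w |-> conj (phi w) k_(psi w)].  Taking [phi = 1] and [psi = id] gives those
    of the combination itself, so domain and range share one formula. *)
Definition kcoef (phi psi : disk -> C) (L : comb) (n : nat) : C :=
  lsum (fun p => fst p * Cconj (phi (snd p)) * Cconj (psi (snd p)) ^ n)%C L.

Definition unit_symbol : disk -> C := fun _ => RtoC 1.

(** The squared Hardy norm of the combination of Szego kernels. *)
Definition gram (L : comb) : C :=
  lsum (fun p => lsum (fun q =>
    fst p * Cconj (fst q) / (1 - Cconj (snd p) * snd q))%C L) L.

Lemma kcoef_app (phi psi : disk -> C) (L M : comb) (n : nat) :
  kcoef phi psi (L ++ M) n = (kcoef phi psi L n + kcoef phi psi M n)%C.
Proof. apply lsum_app. Qed.

Definition cscale (a : C) (L : comb) : comb := map (fun p => (a * fst p, snd p)%C) L.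

Lemma kcoef_cscale (phi psi : disk -> C) (a : C) (L : comb) (n : nat) :
  kcoef phi psi (cscale a L) n = (a * kcoef phi psi L n)%C.
Proof.
  unfold kcoef, cscale. rewrite lsum_map, <- lsum_scal.
  apply lsum_ext; intros; simpl; ring.
Qed.

Lemma Cconj_1 : Cconj 1 = RtoC 1.
Proof. apply C_ext; simpl; ring. Qed.

Lemma kcoef_reweight (phi psi : disk -> C) (L : comb) (n : nat) :
  kcoef phi psi (reweight psi L) n = kcoef phi psi L (S n).
Proof.
  unfold kcoef, reweight. rewrite lsum_map.
  apply lsum_ext; intros; simpl. ring.
Qed.

Lemma one_minus_neq_0 (x : C) : Cmod x < 1 -> (1 - x)%C <> RtoC 0.
Proof.
  intros H E. assert (Hx : x = RtoC 1).
  { replace x with (1 - (1 - x))%C by ring. rewrite E. ring. }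
  rewrite Hx, Cmod_1 in H. lra.
Qed.

Lemma disk_lt (w : disk) : Cmod w < 1.
Proof. exact (proj2_sig w). Qed.

Lemma Cmod_mult_lt_1 (a c : C) : Cmod a < 1 -> Cmod c < 1 -> Cmod (a * c)%C < 1.
Proof.
  intros Ha Hc. rewrite Cmod_mult.
  pose proof (Cmod_ge_0 a); pose proof (Cmod_ge_0 c). nra.
Qed.

Lemma disk_kernel_neq_0 (w z : disk) : (1 - Cconj w * z)%C <> RtoC 0.
Proof.
  apply one_minus_neq_0. apply Cmod_mult_lt_1; [rewrite Cmod_conj|]; apply disk_lt.
Qed.

(** The identity [1 / (1-x) = (1-y) / (1-x) + y / (1-x)], with [x] and [y] built from
    the points and from the values of [mu].  For [mu = id] the first term is the
    squared modulus of a Taylor coefficient, for [mu = b] it is the squared norm of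
    a combination of de Branges-Rovnyak kernels. *)
Lemma gram_split (mu : disk -> C) (L : comb) :
  gram L = (lsum (fun p => lsum (fun q => fst p * Cconj (fst q) *
     ((1 - Cconj (mu (snd p)) * mu (snd q)) / (1 - Cconj (snd p) * snd q)))%C L) L
     + gram (reweight mu L))%C.
Proof.
  unfold gram, reweight. rewrite lsum_map, <- lsum_plus.
  apply lsum_ext; intros p. rewrite lsum_map, <- lsum_plus.
  apply lsum_ext; intros q. simpl.
  rewrite Cmult_conj, Cconj_conj. field. apply disk_kernel_neq_0.
Qed.

Lemma gram_step (L : comb) :
  Re (gram L) = Cmod (kcoef unit_symbol disk_val L 0) ^ 2 + Re (gram (reweight disk_val L)).
Proof.
  rewrite (gram_split disk_val L).
  replace (lsum _ L) with (RtoC (Cmod (kcoef unit_symbol disk_val L 0) ^ 2)).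
  { reflexivity. }
  rewrite Cmod2_conj. unfold kcoef. rewrite lsum_conj.
  rewrite Cmult_comm, <- lsum_scal.
  apply lsum_ext; intros p. rewrite Cmult_comm, <- lsum_scal.
  apply lsum_ext; intros q. unfold unit_symbol. simpl Cpow.
  rewrite !Cmult_conj, !Cconj_conj, Cconj_1. field. apply disk_kernel_neq_0.
Qed.

Fixpoint reweights (mu : disk -> C) (n : nat) (L : comb) : comb :=
  match n with O => L | S m => reweights mu m (reweight mu L) end.

Lemma reweight_reweights (mu : disk -> C) (n : nat) (L : comb) :
  reweights mu n (reweight mu L) = reweight mu (reweights mu n L).
Proof. revert L; induction n; simpl; intros; auto. Qed.

Lemma kcoef_reweights (phi psi : disk -> C) (m : nat) (L : comb) (n : nat) :
  kcoef phi psi (reweights psi m L) n = kcoef phi psi L (m + n).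
Proof.
  revert L n; induction m; simpl; intros; auto.
  now rewrite IHm, kcoef_reweight.
Qed.

(** Parseval with remainder: iterating [gram_step] peels off the Taylor coefficients
    one at a time. *)
Lemma gram_partial_sum (L : comb) (n : nat) :
  Re (gram L) = rsum (fun k => Cmod (kcoef unit_symbol disk_val L k) ^ 2) n
                + Re (gram (reweights disk_val n L)).
Proof.
  induction n; cbn [rsum]; [simpl; ring|].
  rewrite IHn, (gram_step (reweights disk_val n L)), kcoef_reweights.
  cbn [reweights]. rewrite reweight_reweights, Nat.add_0_r. ring.
Qed.

Lemma reweights_map (mu : disk -> C) (n : nat) (L : comb) :
  reweights mu n L = map (fun p => (fst p * Cconj (mu (snd p)) ^ n, snd p)%C) L.
Proof.
  revert L; induction n; simpl; intros L.
  - rewrite <- (map_id L) at 1. apply map_ext. intros [c w].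
    apply (f_equal2 (@pair C disk)); [simpl; ring | reflexivity].
  - rewrite IHn. unfold reweight. rewrite map_map. apply map_ext; intros [c w].
    apply (f_equal2 (@pair C disk)); [simpl; ring | reflexivity].
Qed.

Lemma clim_geom (a x : C) : Cmod x < 1 -> clim (fun n => a * x ^ n)%C 0.
Proof.
  intros Hx. apply is_lim_seq_ext with (fun n => Cmod a * Cmod x ^ n).
  - intros n. replace (a * x ^ n - 0)%C with (a * x ^ n)%C by ring.
    now rewrite Cmod_mult, Cmod_pow.
  - replace (Finite 0) with (Rbar_mult (Cmod a) 0) by (simpl; f_equal; ring).
    apply is_lim_seq_scal_l, is_lim_seq_geom.
    pose proof (Cmod_ge_0 x). rewrite Rabs_pos_eq; auto.
Qed.

Lemma lsum_0 (L : comb) : lsum (fun _ => RtoC 0) L = RtoC 0.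
Proof. induction L; simpl; auto. rewrite IHL; ring. Qed.

Lemma gram_reweights_lim (L : comb) :
  is_lim_seq (fun n => Re (gram (reweights disk_val n L))) 0.
Proof.
  change (Finite 0) with (Finite (Re (RtoC 0))). apply clim_Re.
  apply clim_ext with (fun n => lsum (fun p => lsum (fun q =>
    (fst p * Cconj (fst q) / (1 - Cconj (snd p) * snd q))
       * (Cconj (snd p) * snd q) ^ n)%C L) L).
  - intros n. rewrite reweights_map. unfold gram. rewrite lsum_map.
    apply lsum_ext; intros p. rewrite lsum_map. apply lsum_ext; intros q. simpl.
    rewrite Cmult_conj, Cpow_mult_l, Cpow_conj, Cconj_conj.
    field. apply disk_kernel_neq_0.
  - rewrite <- (lsum_0 L). apply lsum_clim. intros p.
    rewrite <- (lsum_0 L). apply lsum_clim. intros q.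
    apply clim_geom, Cmod_mult_lt_1; [rewrite Cmod_conj|]; apply disk_lt.
Qed.

Lemma gram_nonneg (L : comb) : 0 <= Re (gram L).
Proof.
  assert (H : Rbar_le 0 (Re (gram L))); [|exact H].
  apply is_lim_seq_le with (fun n => Re (gram (reweights disk_val n L)))
                           (fun _ => Re (gram L)).
  - intros n. rewrite (gram_partial_sum L n).
    assert (0 <= rsum (fun k => Cmod (kcoef unit_symbol disk_val L k) ^ 2) n); [|lra].
    apply rsum_nonneg; intros; apply pow2_ge_0.
  - apply gram_reweights_lim.
  - apply is_lim_seq_const.
Qed.

Lemma gram_le (L : comb) (A : R) :
  l2_le (kcoef unit_symbol disk_val L) A -> Re (gram L) <= A ^ 2.
Proof.
  intros [HA H].
  assert (HH : Rbar_le (Re (gram L)) (A ^ 2 + 0)).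
  { apply is_lim_seq_le with (fun _ => Re (gram L))
      (fun n => A ^ 2 + Re (gram (reweights disk_val n L))).
    - intros n. rewrite (gram_partial_sum L n). specialize (H n). lra.
    - apply is_lim_seq_const.
    - apply is_lim_seq_plus'; [apply is_lim_seq_const | apply gram_reweights_lim]. }
  simpl in HH. lra.
Qed.

(** * Combinations of de Branges-Rovnyak kernels *)

Definition hcomb (k : disk -> disk -> C) (L : comb) : disk -> C :=
  fold_right (fun p g => fadd (fscal (fst p) (fun z => k z (snd p))) g) fzero L.

Lemma inner_add_r {X : Type} (H : hilbert_function_space X) (f g h : X -> C) :
  hfs_mem H f -> hfs_mem H g -> hfs_mem H h ->
  hfs_inner H f (fadd g h) = (hfs_inner H f g + hfs_inner H f h)%C.
Proof.
  intros Hf Hg Hh. pose proof (hfs_mem_add _ H g h Hg Hh).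
  rewrite (hfs_inner_conj _ H (fadd g h) f), hfs_inner_add by auto.
  rewrite Cplus_conj, <- !hfs_inner_conj by auto. reflexivity.
Qed.

Lemma inner_scal_r {X : Type} (H : hilbert_function_space X) (a : C) (f g : X -> C) :
  hfs_mem H f -> hfs_mem H g ->
  hfs_inner H f (fscal a g) = (Cconj a * hfs_inner H f g)%C.
Proof.
  intros Hf Hg. pose proof (hfs_mem_scal _ H a g Hg).
  rewrite (hfs_inner_conj _ H (fscal a g) f), hfs_inner_scal by auto.
  rewrite Cmult_conj, <- hfs_inner_conj by auto. reflexivity.
Qed.

Lemma inner_self_real {X : Type} (H : hilbert_function_space X) (f : X -> C) :
  hfs_mem H f -> hfs_inner H f f = RtoC (Re (hfs_inner H f f)).
Proof.
  intros Hf. pose proof (f_equal Im (hfs_inner_conj _ H f f Hf Hf)) as E.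
  rewrite im_conj in E. apply C_ext; simpl; [reflexivity | unfold Im in *; lra].
Qed.

(** Expand the squared norm of [h - t <h,f> f], a quadratic in the real number [t]. *)
Lemma cauchy_schwarz {X : Type} (H : hilbert_function_space X) (h f : X -> C) :
  hfs_mem H h -> hfs_mem H f ->
  Cmod (hfs_inner H h f) ^ 2 <= Re (hfs_inner H h h) * Re (hfs_inner H f f).
Proof.
  intros Hh Hf.
  set (v := hfs_inner H h f). set (a := Re (hfs_inner H h h)).
  set (c := Re (hfs_inner H f f)). set (p := Cmod v ^ 2).
  assert (Q : forall t : R, 0 <= a - 2 * t * p + t ^ 2 * p * c).
  { intros t.
    set (lam := (- (RtoC t * v))%C).
    pose proof (hfs_mem_scal _ H lam f Hf) as Hs.
    pose proof (hfs_mem_add _ H h _ Hh Hs) as Ha.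
    pose proof (hfs_inner_pos _ H _ Ha) as P.
    rewrite hfs_inner_add, !inner_add_r, !inner_scal_r, !hfs_inner_scal in P by auto.
    rewrite (hfs_inner_conj _ H h f Hh Hf) in P. fold v in P.
    rewrite (inner_self_real H h Hh), (inner_self_real H f Hf) in P. fold a c in P.
    assert (E : (RtoC a + Cconj lam * v + (lam * Cconj v + Cconj lam * (lam * RtoC c)))%C
       = RtoC (a - 2 * t * p + t ^ 2 * p * c)).
    { unfold lam, p. rewrite Cmod2_alt. destruct v as [x y]. apply C_ext; simpl; ring. }
    rewrite E in P. exact P. }
  assert (Hp : 0 <= p) by apply pow2_ge_0.
  assert (Hc : 0 <= c) by now apply hfs_inner_pos.
  destruct (Req_dec c 0) as [Hc0|Hc0].
  - destruct (Req_dec p 0) as [->|Hp0]; [rewrite Hc0; lra|].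
    (* The quadratic degenerates to [a - 2 t p], which is [-1] for this [t]. *)
    specialize (Q ((a + 1) / (2 * p))). rewrite Hc0 in Q.
    replace (a - 2 * ((a + 1) / (2 * p)) * p + ((a + 1) / (2 * p)) ^ 2 * p * 0)
      with (-1) in Q by (field; lra). lra.
  - (* The minimum of the quadratic. *)
    specialize (Q (/ c)).
    replace (a - 2 * / c * p + (/ c) ^ 2 * p * c) with (/ c * (a * c - p)) in Q
      by (field; lra).
    assert (0 < / c) by (apply Rinv_0_lt_compat; lra). nra.
Qed.

Lemma hcomb_mem (H : hilbert_function_space disk) (k : disk -> disk -> C) (L : comb) :
  reproducing_kernel H k -> hfs_mem H (hcomb k L).
Proof.
  intros [Hk _]; induction L; simpl; [apply hfs_mem_zero|].
  apply hfs_mem_add; auto. apply hfs_mem_scal; auto.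
Qed.

Lemma inner_zero_l {X : Type} (H : hilbert_function_space X) (f : X -> C) :
  hfs_mem H f -> hfs_inner H fzero f = RtoC 0.
Proof.
  intros Hf. pose proof (hfs_mem_zero _ H) as Hz.
  assert (E : hfs_inner H (fscal 0 fzero) f = RtoC 0).
  { rewrite hfs_inner_scal by auto. ring. }
  rewrite <- E. f_equal. apply functional_extensionality.
  intros x. unfold fscal, fzero. ring.
Qed.

Lemma inner_hcomb (H : hilbert_function_space disk) (k : disk -> disk -> C)
  (L : comb) (f : disk -> C) : reproducing_kernel H k -> hfs_mem H f ->
  hfs_inner H (hcomb k L) f = lsum (fun p => fst p * Cconj (f (snd p)))%C L.
Proof.
  intros HH Hf. destruct (HH) as [Hk Hr].
  induction L; simpl; [now apply inner_zero_l|].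
  rewrite hfs_inner_add, hfs_inner_scal, IHL by
    (auto; first [apply hfs_mem_scal; auto | now apply hcomb_mem]).
  f_equal. f_equal. rewrite (hfs_inner_conj _ H f _) by auto. now rewrite Hr.
Qed.

Lemma hcomb_eval (k : disk -> disk -> C) (L : comb) (z : disk) :
  hcomb k L z = lsum (fun p => fst p * k z (snd p))%C L.
Proof. induction L; simpl; auto. unfold fadd at 1. rewrite IHL. reflexivity. Qed.

(** The first term of [gram_split] for [mu = b] is a squared norm by the reproducing
    property, because its quotient is the de Branges-Rovnyak kernel. *)
Lemma gram_dBR_step (b : disk -> C) (H : hilbert_function_space disk) (L : comb) :
  is_de_Branges_Rovnyak b H ->
  Re (gram L) = Re (hfs_inner H (hcomb (dBR_kernel b) L) (hcomb (dBR_kernel b) L))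
                + Re (gram (reweight b L)).
Proof.
  intros HH. rewrite (gram_split b L), (inner_hcomb _ _ _ _ HH) by now apply hcomb_mem.
  change (Re ?x + Re ?y) with (Re (x + y)%C). do 2 f_equal.
  apply lsum_ext; intros p. rewrite hcomb_eval, lsum_conj, <- lsum_scal.
  apply lsum_ext; intros q. unfold dBR_kernel.
  rewrite Cmult_conj, Cdiv_conj by apply disk_kernel_neq_0.
  rewrite !Cminus_conj, !Cmult_conj, !Cconj_conj, Cconj_1.
  rewrite (Cmult_comm (snd q)), (Cmult_comm (b (snd q))).
  field. apply disk_kernel_neq_0.
Qed.

(** One half of the isometry of [k_w |-> (conj (b w) ^ n k^b_w)_n]: the squared norms
    of the first components add up to the squared Hardy norm minus a Gram form. *)
Lemma gram_dBR_partial_sum (b : disk -> C) (H : hilbert_function_space disk)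
  (L : comb) (n : nat) : is_de_Branges_Rovnyak b H ->
  rsum (fun m => Re (hfs_inner H (hcomb (dBR_kernel b) (reweights b m L))
                                 (hcomb (dBR_kernel b) (reweights b m L)))) n
  = Re (gram L) - Re (gram (reweights b n L)).
Proof.
  intros HH. induction n; cbn [rsum]; [simpl; ring|].
  rewrite IHn, (gram_dBR_step b H (reweights b n L) HH).
  cbn [reweights]. rewrite reweight_reweights. ring.
Qed.

(** The heart of the proof.  The [n]-th coefficient of the image is the inner product
    with [f] of the [n]-th component of the isometry [k_w |-> (conj (b w) ^ n k^b_w)_n]
    into a direct sum of copies of the de Branges-Rovnyak space, so the
    Cauchy-Schwarz inequality in each copy gives the bound. *)
Lemma kcoef_bound (b : disk -> C) (H : hilbert_function_space disk) (f : disk -> C)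
  (L : comb) (A : R) : is_de_Branges_Rovnyak b H -> hfs_mem H f ->
  l2_le (kcoef unit_symbol disk_val L) A -> l2_le (kcoef f b L) (hfs_norm H f * A).
Proof.
  intros HH Hf HL. split.
  { apply Rmult_le_pos; [apply sqrt_pos | apply HL]. }
  intros n.
  set (F := Re (hfs_inner H f f)).
  assert (HF : 0 <= F) by now apply hfs_inner_pos.
  apply Rle_trans with (F * rsum (fun m =>
     Re (hfs_inner H (hcomb (dBR_kernel b) (reweights b m L))
                     (hcomb (dBR_kernel b) (reweights b m L)))) n).
  - rewrite <- rsum_scal. apply rsum_le. intros m _.
    pose proof (cauchy_schwarz H (hcomb (dBR_kernel b) (reweights b m L)) f
                  (hcomb_mem _ _ _ HH) Hf) as CS.
    rewrite (inner_hcomb _ _ _ _ HH Hf) in CS.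
    replace (kcoef f b L m) with
      (lsum (fun p => fst p * Cconj (f (snd p)))%C (reweights b m L)).
    { fold F in CS. lra. }
    rewrite reweights_map, lsum_map. apply lsum_ext; intros p; simpl; ring.
  - rewrite (gram_dBR_partial_sum b H L n HH).
    pose proof (gram_le L A HL). pose proof (gram_nonneg (reweights b n L)).
    unfold hfs_norm. fold F. rewrite Rpow_mult_distr, pow2_sqrt by auto.
    apply Rmult_le_compat_l; lra.
Qed.

(** A value of modulus one would make the kernel at that point a null vector,
    hence zero, and this forces [b] to be constant. *)
Lemma dBR_symbol_lt_1 (b : disk -> C) (H : hilbert_function_space disk) :
  is_de_Branges_Rovnyak b H -> Rbar_le (sup_norm b) 1 ->
  ~ (exists c : C, forall z : disk, b z = c) -> forall w : disk, Cmod (b w) < 1.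
Proof.
  intros [Hk Hr] Hb Hnc w.
  assert (Hle : Cmod (b w) <= 1).
  { assert (HH : Rbar_le (Cmod (b w)) 1); [|exact HH].
    apply Rbar_le_trans with (2 := Hb).
    apply (proj1 (Lub_Rbar_correct _)). now exists w. }
  destruct (Rle_lt_or_eq_dec _ _ Hle) as [|E]; auto.
  assert (Hu : (Cconj (b w) * b w)%C = RtoC 1).
  { rewrite Cmult_comm, <- Cmod2_conj, E. apply C_ext; simpl; ring. }
  exfalso. apply Hnc. exists (b w). intros z.
  pose proof (hfs_inner_def _ H _ (Hk w)) as Hd.
  rewrite (Hr _ w (Hk w)) in Hd. unfold dBR_kernel at 1 in Hd.
  assert (Hz : dBR_kernel b z w = RtoC 0).
  { apply Hd. rewrite Hu. field. apply disk_kernel_neq_0. }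
  assert (Hz2 : (1 - Cconj (b w) * b z)%C = RtoC 0).
  { replace (1 - Cconj (b w) * b z)%C
      with (dBR_kernel b z w * (1 - Cconj w * z))%C.
    - rewrite Hz; ring.
    - unfold dBR_kernel. field. apply disk_kernel_neq_0. }
  transitivity (b w * (Cconj (b w) * b z) + (1 - Cconj (b w) * b w) * b z)%C; [ring|].
  replace (Cconj (b w) * b z)%C with (1 - (1 - Cconj (b w) * b z))%C by ring.
  rewrite Hz2, Hu. ring.
Qed.

(** * Density of the kernels and extension to little l-two *)

Definition approximable (x : nat -> C) : Prop :=
  forall eps, 0 < eps ->
  exists L, l2_le (fun n => kcoef unit_symbol disk_val L n - x n)%C eps.

Definition trunc (x : nat -> C) (N n : nat) : C :=
  if (n <? N)%nat then x n else RtoC 0.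

Definition unit_vec (k n : nat) : C := if (n =? k)%nat then RtoC 1 else RtoC 0.

Lemma approximable_ext (x y : nat -> C) :
  (forall n, x n = y n) -> approximable x -> approximable y.
Proof.
  intros E H eps Heps. destruct (H eps Heps) as [L HL]. exists L.
  apply l2_le_ext with (2 := HL). intros n; now rewrite E.
Qed.

Lemma approximable_plus (x y : nat -> C) :
  approximable x -> approximable y -> approximable (fun n => x n + y n)%C.
Proof.
  intros Hx Hy eps Heps.
  destruct (Hx (eps / 2)) as [L HL]; [lra|].
  destruct (Hy (eps / 2)) as [M HM]; [lra|].
  exists (L ++ M). replace eps with (eps / 2 + eps / 2) by field.
  apply l2_le_ext with (2 := l2_le_plus _ _ _ _ HL HM).
  intros n; rewrite kcoef_app; ring.
Qed.

Lemma approximable_scal (a : C) (x : nat -> C) :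
  approximable x -> approximable (fun n => a * x n)%C.
Proof.
  intros Hx eps Heps. pose proof (Cmod_ge_0 a).
  assert (0 < Cmod a + 1) by lra.
  destruct (Hx (eps / (Cmod a + 1))) as [L HL]; [now apply Rdiv_lt_0_compat|].
  exists (cscale a L).
  apply l2_le_weaken with (Cmod a * (eps / (Cmod a + 1))).
  - apply l2_le_ext with (2 := l2_le_scal a _ _ HL).
    intros n; rewrite kcoef_cscale; ring.
  - apply Rmult_le_reg_r with (Cmod a + 1); auto.
    replace (Cmod a * (eps / (Cmod a + 1)) * (Cmod a + 1)) with (Cmod a * eps)
      by (field; lra). nra.
Qed.

Lemma approximable_closed (x : nat -> C) :
  (forall eps, 0 < eps ->
     exists y, approximable y /\ l2_le (fun n => y n - x n)%C eps) ->
  approximable x.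
Proof.
  intros H eps Heps. destruct (H (eps / 2)) as [y [Hy Hxy]]; [lra|].
  destruct (Hy (eps / 2)) as [L HL]; [lra|].
  exists L. replace eps with (eps / 2 + eps / 2) by field.
  apply l2_le_ext with (2 := l2_le_plus _ _ _ _ HL Hxy). intros; ring.
Qed.

Lemma l2_le_geom_tail (t : R) (k : nat) : 0 < t -> t <= / 2 ->
  l2_le (fun n => if (n <=? k)%nat then RtoC 0 else (RtoC t ^ (n - k))%C) (2 * t).
Proof.
  intros Ht0 Ht. split; [lra|]. intros n.
  set (u := fun j => Cmod (if (j <=? k)%nat then RtoC 0 else (RtoC t ^ (j - k))%C) ^ 2).
  apply Rle_trans with (rsum u (S k + n)).
  { apply rsum_mono; [intros; apply pow2_ge_0 | lia]. }
  assert (H0 : rsum u (S k) = 0).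
  { apply rsum_zero. intros j Hj. unfold u. replace (j <=? k)%nat with true
      by (symmetry; apply Nat.leb_le; lia). rewrite Cmod_0; ring. }
  (* The extra term dominates the rest of the geometric series. *)
  assert (H : rsum u (S k + n) + 2 * (t ^ 2) ^ S n <= 2 * t ^ 2).
  { induction n.
    - rewrite Nat.add_0_r, H0. simpl. lra.
    - rewrite Nat.add_succ_r. cbn [rsum].
      assert (E : u (S k + n)%nat = (t ^ 2) ^ S n).
      { unfold u. replace (S k + n <=? k)%nat with false
          by (symmetry; apply Nat.leb_gt; lia).
        replace (S k + n - k)%nat with (S n) by lia.
        rewrite Cmod_pow, Cmod_R, Rabs_pos_eq by lra.
        rewrite <- !pow_mult. f_equal; lia. }
      rewrite E.
      assert (0 <= (t ^ 2) ^ S n) by (apply pow_le, pow2_ge_0).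
      replace ((t ^ 2) ^ S (S n)) with (t ^ 2 * (t ^ 2) ^ S n) by (simpl; ring).
      assert (t ^ 2 <= / 4) by nra. nra. }
  assert (0 <= (t ^ 2) ^ S n) by (apply pow_le, pow2_ge_0). nra.
Qed.

Lemma real_disk_point (t : R) : 0 < t -> t <= / 2 -> exists w : disk, disk_val w = RtoC t.
Proof.
  intros H0 H1. assert (H : Cmod (RtoC t) < 1) by (rewrite Cmod_R, Rabs_pos_eq; lra).
  now exists (exist _ (RtoC t) H).
Qed.

(** After removing the lower coefficients of the kernel at a small real point
    [t] and dividing by [t ^ k], what is left tends to the [k]-th unit vector. *)
Lemma approximable_unit_vec (k : nat) :
  (forall x, approximable (trunc x k)) -> approximable (unit_vec k).
Proof.
  intros IH. apply approximable_closed. intros eps Heps.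
  set (t := Rmin (/ 2) (eps / 2)).
  assert (Ht0 : 0 < t) by (apply Rmin_glb_lt; lra).
  assert (Ht1 : t <= / 2) by apply Rmin_l.
  assert (Ht2 : 2 * t <= eps) by (pose proof (Rmin_r (/ 2) (eps / 2)); unfold t; lra).
  destruct (real_disk_point t Ht0 Ht1) as [w Hw].
  assert (Hk : approximable (fun n => RtoC t ^ n)%C).
  { intros e He. exists ((RtoC 1, w) :: nil).
    apply l2_le_zero; [|lra].
    intros n. unfold kcoef, unit_symbol; simpl. rewrite Cconj_1, Hw.
    replace (Cconj (RtoC t)) with (RtoC t) by (apply C_ext; simpl; ring). ring. }
  exists (fun n => / RtoC t ^ k * (RtoC t ^ n + (-1) * trunc (fun m => RtoC t ^ m) k n))%C.
  split.
  - apply approximable_scal, approximable_plus; auto.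
    apply approximable_scal, IH.
  - apply l2_le_weaken with (2 := Ht2).
    apply l2_le_ext with (2 := l2_le_geom_tail t k Ht0 Ht1).
    intros n. unfold trunc, unit_vec.
    assert (Htk : (RtoC t ^ k)%C <> RtoC 0).
    { apply Cpow_nz. intros E. apply RtoC_inj in E. lra. }
    destruct (lt_eq_lt_dec n k) as [[Hn|Hn]|Hn].
    + replace (n <=? k)%nat with true by (symmetry; apply Nat.leb_le; lia).
      replace (n <? k)%nat with true by (symmetry; apply Nat.ltb_lt; lia).
      replace (n =? k)%nat with false by (symmetry; apply Nat.eqb_neq; lia).
      ring.
    + subst n. rewrite Nat.leb_refl, Nat.ltb_irrefl, Nat.eqb_refl. field; auto.
    + replace (n <=? k)%nat with false by (symmetry; apply Nat.leb_gt; lia).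
      replace (n <? k)%nat with false by (symmetry; apply Nat.ltb_ge; lia).
      replace (n =? k)%nat with false by (symmetry; apply Nat.eqb_neq; lia).
      replace n with ((n - k) + k)%nat at 2 by lia.
      rewrite Cpow_add_r. field; auto.
Qed.

Lemma approximable_trunc (k : nat) (x : nat -> C) : approximable (trunc x k).
Proof.
  revert x; induction k; intros x.
  - intros eps Heps. exists nil. apply l2_le_zero; [|lra].
    intros n. unfold trunc, kcoef; simpl. ring.
  - apply approximable_ext with (fun n => trunc x k n + x k * unit_vec k n)%C.
    + intros n. unfold trunc, unit_vec.
      destruct (lt_eq_lt_dec n k) as [[Hn|Hn]|Hn].
      * replace (n <? k)%nat with true by (symmetry; apply Nat.ltb_lt; lia).
        replace (n <? S k)%nat with true by (symmetry; apply Nat.ltb_lt; lia).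
        replace (n =? k)%nat with false by (symmetry; apply Nat.eqb_neq; lia). ring.
      * subst n. rewrite Nat.ltb_irrefl, Nat.eqb_refl.
        replace (k <? S k)%nat with true by (symmetry; apply Nat.ltb_lt; lia). ring.
      * replace (n <? k)%nat with false by (symmetry; apply Nat.ltb_ge; lia).
        replace (n <? S k)%nat with false by (symmetry; apply Nat.ltb_ge; lia).
        replace (n =? k)%nat with false by (symmetry; apply Nat.eqb_neq; lia). ring.
    + apply approximable_plus; auto. apply approximable_scal.
      now apply approximable_unit_vec.
Qed.

(** Density of the span of the kernels. *)
Lemma l2_approximable (x : nat -> C) (A : R) : l2_le x A -> approximable x.
Proof.
  intros [HA Hx]. apply approximable_closed. intros eps Heps.
  assert (Hpos : forall k, 0 <= Cmod (x k) ^ 2) by (intros; apply pow2_ge_0).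
  destruct (rsum_tail_to_0 (fun k => Cmod (x k) ^ 2) (A ^ 2) Hpos Hx) as [l [Hle Hl]].
  apply is_lim_seq_spec in Hl. simpl in Hl.
  assert (He2 : 0 < eps ^ 2) by nra.
  destruct (Hl (mkposreal _ He2)) as [N HN]. simpl in HN.
  specialize (HN N (Nat.le_refl N)). apply Rabs_def2 in HN.
  exists (trunc x N). split; [apply approximable_trunc|].
  split; [lra|]. intros n.
  assert (H : rsum (fun k => Cmod (trunc x N k - x k)%C ^ 2) n
              + rsum (fun k => Cmod (x k) ^ 2) (min n N)
              = rsum (fun k => Cmod (x k) ^ 2) n).
  { induction n; cbn [rsum]; [simpl; ring|].
    rewrite <- IHn.
    destruct (le_lt_dec N n) as [Hn|Hn].
    - replace (trunc x N n) with (RtoC 0).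
      2: { unfold trunc. now rewrite (proj2 (Nat.ltb_ge n N)) by lia. }
      replace (min (S n) N) with (min n N) by lia.
      replace (0 - x n)%C with (- x n)%C by ring. rewrite Cmod_opp. ring.
    - replace (trunc x N n) with (x n).
      2: { unfold trunc. now rewrite (proj2 (Nat.ltb_lt n N)) by lia. }
      replace (min (S n) N) with (S (min n N)) by lia. cbn [rsum].
      replace (min n N) with n by lia.
      replace (x n - x n)%C with (RtoC 0) by ring. rewrite Cmod_0. ring. }
  pose proof (Hle n) as H1.
  destruct (le_lt_dec N n) as [Hn|Hn].
  - replace (min n N) with N in H by lia. simpl in *; lra.
  - replace (min n N) with n in H by lia. simpl in *; lra.
Qed.

(** The closure of the graph of [k_w |-> conj (phi w) k_(psi w)], in coefficients.
    Working with the closed graph makes linearity and the norm bound immediate,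
    before the extension is known to be a function. *)
Definition image (phi psi : disk -> C) (x y : nat -> C) : Prop :=
  forall eps, 0 < eps -> exists L,
    l2_le (fun n => kcoef unit_symbol disk_val L n - x n)%C eps /\
    l2_le (fun n => kcoef phi psi L n - y n)%C eps.

Definition contractive_on_kernels (phi psi : disk -> C) (B : R) : Prop :=
  0 <= B /\
  forall L A, l2_le (kcoef unit_symbol disk_val L) A -> l2_le (kcoef phi psi L) (B * A).

Lemma image_plus (phi psi : disk -> C) (x y u v : nat -> C) :
  image phi psi x y -> image phi psi u v ->
  image phi psi (fun n => x n + u n)%C (fun n => y n + v n)%C.
Proof.
  intros H1 H2 eps Heps.
  destruct (H1 (eps / 2)) as [L [HL HL']]; [lra|].
  destruct (H2 (eps / 2)) as [M [HM HM']]; [lra|].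
  exists (L ++ M). replace eps with (eps / 2 + eps / 2) by field. split.
  - apply l2_le_ext with (2 := l2_le_plus _ _ _ _ HL HM).
    intros n; rewrite kcoef_app; ring.
  - apply l2_le_ext with (2 := l2_le_plus _ _ _ _ HL' HM').
    intros n; rewrite kcoef_app; ring.
Qed.

Lemma image_scal (phi psi : disk -> C) (a : C) (x y : nat -> C) :
  image phi psi x y -> image phi psi (fun n => a * x n)%C (fun n => a * y n)%C.
Proof.
  intros H eps Heps. pose proof (Cmod_ge_0 a).
  assert (0 < Cmod a + 1) by lra.
  destruct (H (eps / (Cmod a + 1))) as [L [HL HL']]; [now apply Rdiv_lt_0_compat|].
  assert (Hle : Cmod a * (eps / (Cmod a + 1)) <= eps).
  { apply Rmult_le_reg_r with (Cmod a + 1); auto.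
    replace (Cmod a * (eps / (Cmod a + 1)) * (Cmod a + 1)) with (Cmod a * eps)
      by (field; lra). nra. }
  exists (cscale a L).
  split; apply l2_le_weaken with (2 := Hle).
  - apply l2_le_ext with (2 := l2_le_scal a _ _ HL).
    intros n; rewrite kcoef_cscale; ring.
  - apply l2_le_ext with (2 := l2_le_scal a _ _ HL').
    intros n; rewrite kcoef_cscale; ring.
Qed.

Lemma image_le (phi psi : disk -> C) (B A : R) (x y : nat -> C) :
  contractive_on_kernels phi psi B -> image phi psi x y -> l2_le x A -> l2_le y (B * A).
Proof.
  intros [HB HC] Hxy Hx. apply l2_le_closed.
  { destruct Hx; nra. }
  intros d Hd. destruct (Hxy (d / (B + 1))) as [L [H1 H2]].
  { apply Rdiv_lt_0_compat; lra. }
  set (e := d / (B + 1)) in *.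
  assert (H3 : l2_le (kcoef unit_symbol disk_val L) (e + A)).
  { apply l2_le_ext with (2 := l2_le_plus _ _ _ _ H1 Hx). intros; ring. }
  apply HC in H3.
  replace (B * A + d) with (B * (e + A) + e) by (unfold e; field; lra).
  apply l2_le_ext with (2 := l2_le_minus _ _ _ _ H3 H2). intros; ring.
Qed.

Lemma image_unique (phi psi : disk -> C) (B : R) (x y z : nat -> C) :
  contractive_on_kernels phi psi B ->
  image phi psi x y -> image phi psi x z -> forall n, y n = z n.
Proof.
  intros HC Hy Hz n.
  pose proof (image_plus _ _ _ _ _ _ Hy (image_scal _ _ (-1)%C _ _ Hz)) as H.
  assert (H0 : l2_le (fun n => x n + (-1) * x n)%C 0).
  { apply l2_le_zero; [intros; ring | lra]. }
  pose proof (l2_le_term _ _ n (image_le _ _ _ _ _ _ HC H H0)) as Hn. simpl in Hn.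
  assert (E : (y n + (-1) * z n)%C = RtoC 0).
  { apply Cmod_eq_0. pose proof (Cmod_ge_0 (y n + (-1) * z n)%C). simpl in *. lra. }
  replace (y n) with (y n + (-1) * z n + z n)%C by ring. rewrite E; ring.
Qed.

(** The estimate on kernels turns an approximating sequence into a Cauchy sequence of
    images, whose coordinatewise limit is an image. *)
Lemma image_exists (phi psi : disk -> C) (B A : R) (x : nat -> C) :
  contractive_on_kernels phi psi B -> l2_le x A -> exists y, image phi psi x y.
Proof.
  intros [HB HC] Hx. apply l2_approximable in Hx.
  set (L := fun m : nat => epsilon (inhabits (@nil (C * disk)))
     (fun L => l2_le (fun n => kcoef unit_symbol disk_val L n - x n)%C (/ (INR m + 1)))).
  assert (HL : forall m, l2_le (fun n => kcoef unit_symbol disk_val (L m) n - x n)%C (/ (INR m + 1))).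
  { intros m. unfold L. apply epsilon_spec. apply Hx, inv_S_pos. }
  assert (HK : forall m j, (m <= j)%nat ->
     l2_le (fun n => kcoef phi psi (L m) n - kcoef phi psi (L j) n)%C
           (2 * B * / (INR m + 1))).
  { intros m j Hmj.
    assert (H1 : l2_le (kcoef unit_symbol disk_val (L m ++ cscale (-1) (L j)))
                       (/ (INR m + 1) + / (INR j + 1))).
    { apply l2_le_ext with (2 := l2_le_minus _ _ _ _ (HL m) (HL j)).
      intros n; rewrite kcoef_app, kcoef_cscale; ring. }
    apply HC in H1.
    apply l2_le_weaken with (B * (/ (INR m + 1) + / (INR j + 1))).
    - apply l2_le_ext with (2 := H1). intros n; rewrite kcoef_app, kcoef_cscale; ring.
    - pose proof (inv_S_le m j Hmj). nra. }
  assert (He : is_lim_seq (fun m => 2 * B * / (INR m + 1)) 0).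
  { replace (Finite 0) with (Rbar_mult (2 * B) 0) by (simpl; f_equal; ring).
    apply is_lim_seq_scal_l, is_lim_seq_inv_S. }
  assert (Hlim : forall n, exists l, clim (fun m => kcoef phi psi (L m) n) l).
  { intros n. apply clim_cauchy with (1 := He). intros m j Hmj.
    rewrite Cmod_minus_sym. exact (l2_le_term _ _ n (HK m j Hmj)). }
  set (y := fun n => epsilon (inhabits (RtoC 0)) (clim (fun m => kcoef phi psi (L m) n))).
  assert (Hy : forall n, clim (fun m => kcoef phi psi (L m) n) (y n)).
  { intros n. unfold y. apply epsilon_spec, Hlim. }
  exists y. intros eps Heps.
  apply is_lim_seq_spec in He. pose proof is_lim_seq_inv_S as Hi.
  apply is_lim_seq_spec in Hi. simpl in He, Hi.
  destruct (He (mkposreal _ Heps)) as [N1 HN1].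
  destruct (Hi (mkposreal _ Heps)) as [N2 HN2].
  set (m := max N1 N2). simpl in HN1, HN2.
  specialize (HN1 m (Nat.le_max_l _ _)). specialize (HN2 m (Nat.le_max_r _ _)).
  apply Rabs_def2 in HN1, HN2.
  exists (L m). split.
  - apply l2_le_weaken with (1 := HL m). lra.
  - apply l2_le_weaken with (2 * B * / (INR m + 1)); [|lra].
    apply l2_le_clim with (2 := HK m). intros n.
    apply clim_ext with (fun j => kcoef phi psi (L m) n + (-1) * kcoef phi psi (L j) n)%C.
    { intros; ring. }
    replace (kcoef phi psi (L m) n - y n)%C with
      (kcoef phi psi (L m) n + (-1) * y n)%C by ring.
    apply clim_plus; [apply clim_const | apply clim_scal, Hy].
Qed.

(** * Complex derivatives *)

Definition cdiff (f : C -> C) (z l : C) : Prop :=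
  forall eps, 0 < eps -> exists d, 0 < d /\ forall y, Cmod (y - z)%C < d ->
    Cmod (f y - f z - (y - z) * l)%C <= eps * Cmod (y - z)%C.

Lemma ex_derive_cdiff (f : C -> C) (z : C) :
  @ex_derive C_AbsRing C_NormedModule f z <-> exists l, cdiff f z l.
Proof.
  split.
  - intros [l [_ Hl]]. exists l. intros eps Heps.
    destruct (Hl z (fun P H => H) (mkposreal _ Heps)) as [d Hd].
    exists d. split; [apply cond_pos|]. intros y Hy. exact (Hd y Hy).
  - intros [l Hl]. exists l. split; [apply is_linear_scal_l|].
    intros x Hx.
    pose proof (@is_filter_lim_locally_unique C_AbsRing
      (AbsRing_NormedModule C_AbsRing) z x Hx) as E. subst x.
    intros eps. destruct (Hl eps (cond_pos eps)) as [d [Hd H]].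
    exists (mkposreal d Hd). intros y Hy. exact (H y Hy).
Qed.

Lemma cdiff_ext_disk (f g : C -> C) (z l : C) : Cmod z < 1 ->
  (forall u, Cmod u < 1 -> f u = g u) -> cdiff f z l -> cdiff g z l.
Proof.
  intros Hz E H eps Heps. destruct (H eps Heps) as [d [Hd Hf]].
  exists (Rmin d (1 - Cmod z)). split; [apply Rmin_glb_lt; lra|].
  intros y Hy. pose proof (Rmin_l d (1 - Cmod z)). pose proof (Rmin_r d (1 - Cmod z)).
  rewrite <- !E; auto; [apply Hf; lra|].
  pose proof (Cmod_triangle (y - z) z) as T.
  replace (y - z + z)%C with y in T by ring. lra.
Qed.

Lemma Cmod_le_2_Rmax (c : C) : Cmod c <= 2 * Rmax (Rabs (Re c)) (Rabs (Im c)).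
Proof.
  pose proof (Cmod_le_abs c).
  pose proof (Rmax_l (Rabs (Re c)) (Rabs (Im c))).
  pose proof (Rmax_r (Rabs (Re c)) (Rabs (Im c))). lra.
Qed.

Lemma cdiff_part (part : C -> R) (f : C -> C) (z l : C) (lx ly : R) :
  (forall c, Rabs (part c) <= Cmod c) ->
  (forall a c, part (a - c)%C = part a - part c) ->
  (forall x y, part ((x, y) * l)%C = lx * x + ly * y) ->
  cdiff f z l ->
  differentiable_pt_lim (fun x y => part (f (x, y))) (Re z) (Im z) lx ly.
Proof.
  intros Hle Hm Hl H eps.
  destruct (H (eps / 2)) as [d [Hd Hf]]. { pose proof (cond_pos eps); lra. }
  assert (Hd2 : 0 < d / 2) by lra.
  exists (mkposreal _ Hd2). simpl. intros u v Hu Hv.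
  assert (Hdist : Cmod ((u, v) - z)%C <= 2 * Rmax (Rabs (u - Re z)) (Rabs (v - Im z)))
    by apply (Cmod_le_2_Rmax ((u, v) - z)%C).
  assert (Hlt : Cmod ((u, v) - z)%C < d).
  { apply Rle_lt_trans with (1 := Hdist).
    assert (Rmax (Rabs (u - Re z)) (Rabs (v - Im z)) < d / 2) by (apply Rmax_lub_lt; auto).
    lra. }
  specialize (Hf _ Hlt).
  replace (part (f (u, v)) - part (f (Re z, Im z))
           - (lx * (u - Re z) + ly * (v - Im z)))
    with (part (f (u, v) - f z - ((u, v) - z) * l)%C).
  - apply Rle_trans with (1 := Hle _). apply Rle_trans with (1 := Hf).
    pose proof (cond_pos eps). nra.
  - rewrite !Hm. replace (Re z, Im z) with z by now destruct z.
    replace ((u, v) - z)%C with ((u - Re z, v - Im z) : C)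
      by (destruct z; reflexivity).
    now rewrite Hl.
Qed.

(** The Cauchy-Riemann equations for the two parts of a holomorphic function. *)
Lemma cdiff_Re (f : C -> C) (z l : C) : cdiff f z l ->
  differentiable_pt_lim (fun x y => Re (f (x, y))) (Re z) (Im z) (Re l) (- Im l).
Proof.
  apply cdiff_part; [apply re_le_Cmod | reflexivity |].
  intros; destruct l; unfold Re, Im; simpl; ring.
Qed.

Lemma cdiff_Im (f : C -> C) (z l : C) : cdiff f z l ->
  differentiable_pt_lim (fun x y => Im (f (x, y))) (Re z) (Im z) (Im l) (Re l).
Proof.
  apply cdiff_part; [apply Im_le_Cmod | reflexivity |].
  intros; destruct l; unfold Re, Im; simpl; ring.
Qed.

(** * Fourier coefficients of continuous functions on the circle *)

Definition tcont (g : R -> C) : Prop :=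
  forall t, continuous (fun s => Re (g s)) t /\ continuous (fun s => Im (g s)) t.

Lemma tcont_Re (g : R -> C) : tcont g -> forall t, continuous (fun s => Re (g s)) t.
Proof. intros H t. exact (proj1 (H t)). Qed.

Lemma tcont_Im (g : R -> C) : tcont g -> forall t, continuous (fun s => Im (g s)) t.
Proof. intros H t. exact (proj2 (H t)). Qed.

Definition mean (u : R -> R) : R := / (2 * PI) * RInt u 0 (2 * PI).

Definition cmean (g : R -> C) : C := (mean (fun t => Re (g t)), mean (fun t => Im (g t))).

Lemma two_PI_pos : 0 < 2 * PI.
Proof. pose proof PI_RGT_0; lra. Qed.

Lemma cont_RInt (u : R -> R) (a b : R) : (forall t, continuous u t) -> ex_RInt u a b.
Proof. intros H. apply (@ex_RInt_continuous R_CompleteNormedModule); auto. Qed.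

Lemma cont_plus (u v : R -> R) (t : R) :
  continuous u t -> continuous v t -> continuous (fun s => u s + v s) t.
Proof. exact (continuous_plus u v t). Qed.

Lemma cont_mult (u v : R -> R) (t : R) :
  continuous u t -> continuous v t -> continuous (fun s => u s * v s) t.
Proof. exact (continuous_mult u v t). Qed.

Lemma cont_minus (u v : R -> R) (t : R) :
  continuous u t -> continuous v t -> continuous (fun s => u s - v s) t.
Proof. exact (continuous_minus u v t). Qed.

Lemma mean_ext (u v : R -> R) : (forall t, u t = v t) -> mean u = mean v.
Proof. intros H. unfold mean. f_equal. apply RInt_ext. auto. Qed.

Lemma mean_plus (u v : R -> R) : (forall t, continuous u t) -> (forall t, continuous v t) ->
  mean (fun t => u t + v t) = mean u + mean v.
Proof.
  intros Hu Hv. unfold mean.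
  pose proof (RInt_plus u v 0 (2 * PI) (cont_RInt _ _ _ Hu) (cont_RInt _ _ _ Hv)) as E.
  unfold plus in E; simpl in E. rewrite E. ring.
Qed.

Lemma mean_scal (a : R) (u : R -> R) : (forall t, continuous u t) ->
  mean (fun t => a * u t) = a * mean u.
Proof.
  intros Hu. unfold mean.
  pose proof (RInt_scal u 0 (2 * PI) a (cont_RInt _ _ _ Hu)) as E.
  unfold scal in E; simpl in E. unfold mult in E; simpl in E. rewrite E. ring.
Qed.

Lemma mean_const (a : R) : mean (fun _ => a) = a.
Proof.
  unfold mean. rewrite RInt_const. unfold scal; simpl; unfold mult; simpl.
  pose proof two_PI_pos. field. lra.
Qed.

Lemma mean_le (u v : R -> R) : (forall t, continuous u t) -> (forall t, continuous v t) ->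
  (forall t, u t <= v t) -> mean u <= mean v.
Proof.
  intros Hu Hv H. pose proof two_PI_pos. unfold mean. apply Rmult_le_compat_l.
  - left. now apply Rinv_0_lt_compat.
  - apply RInt_le; auto using cont_RInt; lra.
Qed.

Lemma cont_cst (a t : R) : continuous (fun _ : R => a) t.
Proof. apply continuous_const. Qed.

Lemma tcont_plus (g h : R -> C) : tcont g -> tcont h -> tcont (fun t => g t + h t)%C.
Proof.
  intros Hg Hh t. destruct (Hg t), (Hh t). split; simpl; now apply cont_plus.
Qed.

Lemma tcont_mult (g h : R -> C) : tcont g -> tcont h -> tcont (fun t => g t * h t)%C.
Proof.
  intros Hg Hh t. destruct (Hg t), (Hh t). unfold Re, Im in *. split; simpl.
  - apply cont_minus; now apply cont_mult.
  - apply cont_plus; now apply cont_mult.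
Qed.

Lemma tcont_const (a : C) : tcont (fun _ => a).
Proof. intros t; split; apply cont_cst. Qed.

Lemma tcont_scal (a : C) (g : R -> C) : tcont g -> tcont (fun t => a * g t)%C.
Proof. intros Hg. apply tcont_mult; auto. apply tcont_const. Qed.

Lemma tcont_minus (g h : R -> C) : tcont g -> tcont h -> tcont (fun t => g t - h t)%C.
Proof.
  intros Hg Hh t. destruct (Hg t), (Hh t). split.
  - exact (cont_minus _ _ _ H H1).
  - exact (cont_minus _ _ _ H0 H2).
Qed.

Lemma tcont_conj (g : R -> C) : tcont g -> tcont (fun t => Cconj (g t)).
Proof.
  intros Hg t. destruct (Hg t) as [H1 H2]. split; [exact H1|].
  exact (continuous_opp _ _ H2).
Qed.

Lemma tcont_csum (g : nat -> R -> C) (n : nat) : (forall k, tcont (g k)) ->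
  tcont (fun t => csum (fun k => g k t) n).
Proof.
  intros H. induction n; simpl; [apply tcont_const | now apply tcont_plus].
Qed.

Lemma cont_Cmod2 (g : R -> C) (t : R) : tcont g -> continuous (fun s => Cmod (g s) ^ 2) t.
Proof.
  intros Hg. destruct (Hg t).
  assert (E : forall s, Re (g s) * Re (g s) + Im (g s) * Im (g s) = Cmod (g s) ^ 2).
  { intros s. rewrite Cmod2_alt. ring. }
  apply (continuous_ext _ _ _ E).
  apply cont_plus; now apply cont_mult.
Qed.

Lemma cmean_ext (g h : R -> C) : (forall t, g t = h t) -> cmean g = cmean h.
Proof.
  intros H. apply C_ext; simpl; apply mean_ext; intros t; now rewrite H.
Qed.

Lemma cmean_plus (g h : R -> C) : tcont g -> tcont h ->
  cmean (fun t => g t + h t)%C = (cmean g + cmean h)%C.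
Proof.
  intros Hg Hh. apply C_ext.
  - exact (mean_plus _ _ (tcont_Re g Hg) (tcont_Re h Hh)).
  - exact (mean_plus _ _ (tcont_Im g Hg) (tcont_Im h Hh)).
Qed.

Lemma cmean_scal (a : C) (g : R -> C) : tcont g ->
  cmean (fun t => a * g t)%C = (a * cmean g)%C.
Proof.
  intros Hg.
  assert (Hr : forall c t, continuous (fun s => c * Re (g s)) t).
  { intros c t. apply cont_mult; [apply cont_cst | now apply tcont_Re]. }
  assert (Hi : forall c t, continuous (fun s => c * Im (g s)) t).
  { intros c t. apply cont_mult; [apply cont_cst | now apply tcont_Im]. }
  apply C_ext; simpl.
  - transitivity (mean (fun t => fst a * Re (g t) + (- snd a) * Im (g t))).
    + apply mean_ext; intros; unfold Re, Im; simpl; ring.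
    + rewrite mean_plus, !mean_scal by (auto using tcont_Re, tcont_Im). ring.
  - transitivity (mean (fun t => fst a * Im (g t) + snd a * Re (g t))).
    + apply mean_ext; intros; unfold Re, Im; simpl; ring.
    + rewrite mean_plus, !mean_scal by (auto using tcont_Re, tcont_Im). ring.
Qed.

(** The character [e^(int)]. *)
Definition chr (n : nat) (t : R) : C := (cos (INR n * t), sin (INR n * t)).

Lemma continuous_of_is_derive (u : R -> R) (t l : R) : is_derive u t l -> continuous u t.
Proof. intros H. apply (@ex_derive_continuous R_AbsRing R_NormedModule). now exists l. Qed.

Lemma tcont_chr (n : nat) : tcont (chr n).
Proof.
  intros t; unfold chr; simpl; split.
  - apply continuous_of_is_derive with (- INR n * sin (INR n * t)).
    auto_derive; auto. ring.
  - apply continuous_of_is_derive with (INR n * cos (INR n * t)).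
    auto_derive; auto. ring.
Qed.

Lemma Cmod2_chr (n : nat) (t : R) : Cmod (chr n t) ^ 2 = 1.
Proof.
  rewrite Cmod2_alt. unfold chr; simpl. pose proof (sin2_cos2 (INR n * t)) as H.
  unfold Rsqr in H. lra.
Qed.

Lemma sin_2PI_INR (n : nat) : sin (INR n * (2 * PI)) = 0.
Proof.
  replace (INR n * (2 * PI)) with (0 + 2 * INR n * PI) by ring.
  rewrite sin_period. apply sin_0.
Qed.

Lemma cos_2PI_INR (n : nat) : cos (INR n * (2 * PI)) = 1.
Proof.
  replace (INR n * (2 * PI)) with (0 + 2 * INR n * PI) by ring.
  rewrite cos_period. apply cos_0.
Qed.

Lemma chr_orthogonal (n m : nat) : n <> m ->
  cmean (fun t => chr n t * Cconj (chr m t))%C = RtoC 0.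
Proof.
  intros Hnm. set (d := INR n - INR m).
  assert (Hd : d <> 0). { unfold d. intros E. apply Hnm, INR_eq. lra. }
  assert (Hs : sin (d * (2 * PI)) = 0).
  { replace (d * (2 * PI)) with (INR n * (2 * PI) - INR m * (2 * PI)) by (unfold d; ring).
    rewrite sin_minus, !sin_2PI_INR. ring. }
  assert (Hc : cos (d * (2 * PI)) = 1).
  { replace (d * (2 * PI)) with (INR n * (2 * PI) - INR m * (2 * PI)) by (unfold d; ring).
    rewrite cos_minus, !sin_2PI_INR, !cos_2PI_INR. ring. }
  apply C_ext; simpl.
  - rewrite (mean_ext _ (fun t => cos (d * t))).
    + unfold mean.
      rewrite (is_RInt_unique (fun t => cos (d * t)) _ _
        (minus (sin (d * (2 * PI)) / d) (sin (d * 0) / d))).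
      * rewrite Hs, Rmult_0_r, sin_0. unfold minus, plus, opp; simpl. field.
        pose proof PI_RGT_0; split; lra.
      * apply (is_RInt_derive (fun t => sin (d * t) / d)).
        -- intros t _. auto_derive; auto. field; auto.
        -- intros t _. apply continuous_of_is_derive with (- d * sin (d * t)).
           auto_derive; auto. ring.
    + intros t. unfold chr; simpl.
      replace (d * t) with (INR n * t - INR m * t) by (unfold d; ring).
      rewrite cos_minus. ring.
  - rewrite (mean_ext _ (fun t => sin (d * t))).
    + unfold mean.
      rewrite (is_RInt_unique (fun t => sin (d * t)) _ _
        (minus (- cos (d * (2 * PI)) / d) (- cos (d * 0) / d))).
      * rewrite Hc, Rmult_0_r, cos_0. unfold minus, plus, opp; simpl. field.
        pose proof PI_RGT_0; split; lra.
      * apply (is_RInt_derive (fun t => - cos (d * t) / d)).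
        -- intros t _. auto_derive; auto. field; auto.
        -- intros t _. apply continuous_of_is_derive with (d * cos (d * t)).
           auto_derive; auto. ring.
    + intros t. unfold chr; simpl.
      replace (d * t) with (INR n * t - INR m * t) by (unfold d; ring).
      rewrite sin_minus. ring.
Qed.

Definition fcoef (g : R -> C) (n : nat) : C := cmean (fun t => g t * Cconj (chr n t))%C.

Definition tpoly (c : nat -> C) (N : nat) (t : R) : C :=
  csum (fun k => c k * chr k t)%C N.

Lemma tcont_tpoly (c : nat -> C) (N : nat) : tcont (tpoly c N).
Proof.
  apply (tcont_csum (fun k t => c k * chr k t)%C). intros k.
  apply tcont_scal, tcont_chr.
Qed.

Lemma tcont_mult_chr (g : R -> C) (n : nat) :
  tcont g -> tcont (fun t => g t * Cconj (chr n t))%C.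
Proof. intros H. apply tcont_mult; auto. apply tcont_conj, tcont_chr. Qed.

Lemma fcoef_tpoly (c : nat -> C) (N m : nat) : (N <= m)%nat ->
  fcoef (tpoly c N) m = RtoC 0.
Proof.
  induction N; intros H; unfold fcoef.
  - rewrite (cmean_ext _ (fun _ => RtoC 0)).
    + apply C_ext; simpl; apply mean_const.
    + intros t. unfold tpoly; simpl. ring.
  - rewrite (cmean_ext _ (fun t => tpoly c N t * Cconj (chr m t)
        + c N * (chr N t * Cconj (chr m t)))%C).
    2: { intros t; unfold tpoly; simpl csum. ring. }
    rewrite cmean_plus, cmean_scal.
    + unfold fcoef in IHN. rewrite IHN by lia. rewrite chr_orthogonal by lia. ring.
    + apply tcont_mult_chr, tcont_chr.
    + apply tcont_mult_chr, tcont_tpoly.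
    + apply tcont_scal, tcont_mult_chr, tcont_chr.
Qed.

(** The Pythagoras theorem for the orthonormal system of characters.  Keeping the
    polynomial arbitrary gives both the Bessel inequality and the uniqueness of the
    coefficients of a uniformly convergent series. *)
Lemma mean_sub_tpoly (g : R -> C) (c : nat -> C) (N : nat) : tcont g ->
  mean (fun t => Cmod (g t - tpoly c N t)%C ^ 2) =
  mean (fun t => Cmod (g t) ^ 2)
  + rsum (fun k => Cmod (c k - fcoef g k)%C ^ 2 - Cmod (fcoef g k) ^ 2) N.
Proof.
  intros Hg. induction N; cbn [rsum].
  - rewrite Rplus_0_r. apply mean_ext; intros t. unfold tpoly; cbn [csum].
    replace (g t - 0)%C with (g t) by ring. reflexivity.
  - rewrite <- Rplus_assoc, <- IHN.
    set (u := fun t => (g t - tpoly c N t)%C).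
    assert (Hu : tcont u) by (apply tcont_minus; auto using tcont_tpoly).
    assert (Huc : tcont (fun t => u t * Cconj (chr N t))%C) by now apply tcont_mult_chr.
    assert (Hf : cmean (fun t => u t * Cconj (chr N t))%C = fcoef g N).
    { rewrite (cmean_ext _ (fun t => g t * Cconj (chr N t)
          + (-1) * (tpoly c N t * Cconj (chr N t)))%C).
      2: { intros; unfold u; ring. }
      rewrite cmean_plus, cmean_scal.
      - fold (fcoef (tpoly c N) N). rewrite fcoef_tpoly by auto. fold (fcoef g N). ring.
      - apply tcont_mult_chr, tcont_tpoly.
      - now apply tcont_mult_chr.
      - apply tcont_scal, tcont_mult_chr, tcont_tpoly. }
    transitivity (mean (fun t => Cmod (u t) ^ 2 + (Cmod (c N) ^ 2
       + (-2) * Re (Cconj (c N) * (u t * Cconj (chr N t)))%C))).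
    { apply mean_ext; intros t.
      replace (g t - tpoly c (S N) t)%C with (u t - c N * chr N t)%C
        by (unfold u, tpoly; cbn [csum]; ring).
      replace (Cmod (c N) ^ 2) with (Cmod (c N) ^ 2 * Cmod (chr N t) ^ 2)
        by (rewrite Cmod2_chr; ring).
      rewrite !Cmod2_alt. destruct (u t), (c N), (chr N t). unfold Re, Im; simpl. ring. }
    rewrite !mean_plus, mean_const, mean_scal.
    + change (mean (fun t => Re (Cconj (c N) * (u t * Cconj (chr N t)))%C))
        with (Re (cmean (fun t => Cconj (c N) * (u t * Cconj (chr N t)))%C)).
      rewrite cmean_scal, Hf by auto. unfold u.
      rewrite !Cmod2_alt. destruct (c N), (fcoef g N). unfold Re, Im; simpl. ring.
    + intros t. exact (tcont_Re _ (tcont_scal (Cconj (c N)) _ Huc) t).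
    + intros; apply cont_cst.
    + intros t. apply cont_mult; [apply cont_cst|]. exact (tcont_Re _ (tcont_scal (Cconj (c N)) _ Huc) t).
    + intros t. now apply cont_Cmod2.
    + intros t. apply cont_plus; [apply cont_cst|].
      apply cont_mult; [apply cont_cst|]. exact (tcont_Re _ (tcont_scal (Cconj (c N)) _ Huc) t).
Qed.

Lemma mean_Cmod2_nonneg (g : R -> C) : tcont g -> 0 <= mean (fun t => Cmod (g t) ^ 2).
Proof.
  intros Hg. rewrite <- (mean_const 0). apply mean_le; intros t.
  - apply cont_cst.
  - now apply cont_Cmod2.
  - apply pow2_ge_0.
Qed.

Lemma bessel (g : R -> C) (N : nat) : tcont g ->
  rsum (fun k => Cmod (fcoef g k) ^ 2) N <= mean (fun t => Cmod (g t) ^ 2).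
Proof.
  intros Hg. pose proof (mean_sub_tpoly g (fcoef g) N Hg) as E.
  pose proof (mean_Cmod2_nonneg _ (tcont_minus _ _ Hg (tcont_tpoly (fcoef g) N))) as P.
  cbv beta in P. rewrite E in P.
  rewrite (rsum_ext _ (fun k => (-1) * Cmod (fcoef g k) ^ 2)) in P.
  - rewrite rsum_scal in P. lra.
  - intros k _. replace (fcoef g k - fcoef g k)%C with (RtoC 0) by ring.
    rewrite Cmod_0. ring.
Qed.

Lemma mean_uniform_le (g : R -> C) (tau : R) : tcont g -> (forall t, Cmod (g t) <= tau) ->
  mean (fun t => Cmod (g t) ^ 2) <= tau ^ 2.
Proof.
  intros Hg H. rewrite <- (mean_const (tau ^ 2)). apply mean_le; intros t.
  - now apply cont_Cmod2.
  - apply cont_cst.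
  - apply pow_incr. split; [apply Cmod_ge_0 | auto].
Qed.

Lemma is_lim_seq_sq_0 (tau : nat -> R) :
  is_lim_seq tau 0 -> is_lim_seq (fun n => tau n ^ 2) 0.
Proof.
  intros H. replace (Finite 0) with (Finite (0 * 0)) by (f_equal; ring).
  apply is_lim_seq_ext with (fun n => tau n * tau n). { intros; ring. }
  now apply is_lim_seq_mult'.
Qed.

(** By [mean_sub_tpoly] and [bessel], the distance between the coefficients is at most
    the distance in mean, hence at most the uniform distance. *)
Lemma fcoef_of_uniform_series (g : R -> C) (c : nat -> C) (tau : nat -> R) :
  tcont g -> is_lim_seq tau 0 ->
  (forall N t, Cmod (g t - tpoly c N t)%C <= tau N) -> forall k, fcoef g k = c k.
Proof.
  intros Hg Htau H k.
  assert (Hk : forall N, (S k <= N)%nat -> Cmod (c k - fcoef g k)%C ^ 2 <= tau N ^ 2).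
  { intros N HN.
    pose proof (mean_uniform_le _ _ (tcont_minus _ _ Hg (tcont_tpoly c N)) (H N)) as U.
    cbv beta in U. rewrite (mean_sub_tpoly g c N Hg) in U.
    pose proof (bessel g N Hg) as B.
    rewrite (rsum_ext _ (fun k => Cmod (c k - fcoef g k)%C ^ 2
        + (-1) * Cmod (fcoef g k) ^ 2)) in U by (intros; ring).
    rewrite rsum_plus, rsum_scal in U.
    assert (Hp : forall j, 0 <= Cmod (c j - fcoef g j)%C ^ 2) by (intros; apply pow2_ge_0).
    pose proof (rsum_mono _ _ _ Hp HN) as M.
    pose proof (rsum_term_le _ k Hp). simpl in *. lra. }
  assert (L : Rbar_le (Cmod (c k - fcoef g k)%C ^ 2) 0).
  { apply is_lim_seq_le_loc with (fun _ => Cmod (c k - fcoef g k)%C ^ 2) (fun N => tau N ^ 2).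
    - now exists (S k).
    - apply is_lim_seq_const.
    - now apply is_lim_seq_sq_0. }
  simpl in L.
  assert (E : (c k - fcoef g k)%C = RtoC 0).
  { apply Cmod_eq_0. pose proof (Cmod_ge_0 (c k - fcoef g k)%C). nra. }
  replace (fcoef g k) with (c k - (c k - fcoef g k))%C by ring. rewrite E. ring.
Qed.

Lemma mean_le_of_uniform_series (g : R -> C) (c : nat -> C) (tau : nat -> R) (A : R) :
  tcont g -> is_lim_seq tau 0 ->
  (forall N t, Cmod (g t - tpoly c N t)%C <= tau N) -> l2_le c A ->
  mean (fun t => Cmod (g t) ^ 2) <= A ^ 2.
Proof.
  intros Hg Htau H [HA Hc].
  assert (L : Rbar_le (mean (fun t => Cmod (g t) ^ 2)) (A ^ 2 + 0)).
  { apply is_lim_seq_le with (fun _ => mean (fun t => Cmod (g t) ^ 2))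
      (fun N => A ^ 2 + tau N ^ 2).
    - intros N.
      pose proof (mean_uniform_le _ _ (tcont_minus _ _ Hg (tcont_tpoly c N)) (H N)) as U.
      cbv beta in U. rewrite (mean_sub_tpoly g c N Hg) in U.
      rewrite (rsum_ext _ (fun k => (-1) * Cmod (c k) ^ 2)) in U.
      + rewrite rsum_scal in U. specialize (Hc N). lra.
      + intros k _. rewrite (fcoef_of_uniform_series g c tau Hg Htau H k).
        replace (c k - c k)%C with (RtoC 0) by ring. rewrite Cmod_0. ring.
    - apply is_lim_seq_const.
    - apply is_lim_seq_plus'; [apply is_lim_seq_const | now apply is_lim_seq_sq_0]. }
  simpl in L. simpl. lra.
Qed.

(** * Power series with bounded coefficients *)

(** A limit of the partial sums, chosen among all points when there is none. *)
Definition psum (y : nat -> C) (z : C) : C :=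
  epsilon (inhabits (RtoC 0)) (clim (csum (fun n => y n * z ^ n)%C)).

Lemma rsum_geom_le (rho : R) (N : nat) : 0 <= rho < 1 ->
  rsum (fun n => rho ^ n) N <= / (1 - rho).
Proof.
  intros H. assert (E : rsum (fun n => rho ^ n) N = (1 - rho ^ N) / (1 - rho)).
  { induction N; simpl; [field; lra | rewrite IHN; field; lra]. }
  rewrite E. pose proof (pow_le rho N (proj1 H)).
  assert (0 < / (1 - rho)) by (apply Rinv_0_lt_compat; lra). unfold Rdiv. nra.
Qed.

Lemma psum_correct (y : nat -> C) (M : R) (z : C) :
  (forall n, Cmod (y n) <= M) -> Cmod z < 1 ->
  clim (csum (fun n => y n * z ^ n)%C) (psum y z).
Proof.
  intros HM Hz. unfold psum. apply epsilon_spec.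
  pose proof (Cmod_ge_0 z) as Hz0.
  assert (HM0 : 0 <= M) by (pose proof (Cmod_ge_0 (y O)); specialize (HM O); lra).
  apply csum_abs_cv with (M * / (1 - Cmod z)). intros N.
  apply Rle_trans with (rsum (fun n => M * Cmod z ^ n) N).
  - apply rsum_le. intros k _. rewrite Cmod_mult, Cmod_pow.
    apply Rmult_le_compat_r; auto. now apply pow_le.
  - rewrite rsum_scal. apply Rmult_le_compat_l; auto. apply rsum_geom_le; lra.
Qed.

Lemma psum_tail (y : nat -> C) (M rho : R) (z : C) (N : nat) :
  (forall n, Cmod (y n) <= M) -> Cmod z <= rho -> rho < 1 ->
  Cmod (psum y z - csum (fun n => y n * z ^ n)%C N)%C <= M * / (1 - rho) * rho ^ N.
Proof.
  intros HM Hz Hr.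
  pose proof (Cmod_ge_0 z) as Hz0.
  assert (HM0 : 0 <= M) by (pose proof (Cmod_ge_0 (y O)); specialize (HM O); lra).
  assert (Hz1 : Cmod z < 1) by lra.
  set (u := csum (fun n => y n * z ^ n)%C).
  apply clim_le with (fun n => u n + (-1) * u N)%C N.
  - replace (psum y z - u N)%C with (psum y z + (-1) * u N)%C by ring.
    apply clim_plus; [| apply clim_const]. now apply psum_correct with M.
  - intros n Hn. replace (u n + (-1) * u N)%C with (u n - u N)%C by ring.
    apply Rle_trans with (1 := csum_diff_le _ _ _ Hn).
    set (s := fun k => Cmod (y k * z ^ k)%C).
    assert (D : rsum s n - rsum s N <= M * / (1 - rho) * (rho ^ N - rho ^ n)).
    { induction Hn as [|m Hm IH]; [lra|]. cbn [rsum].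
      assert (s m <= M * rho ^ m).
      { unfold s. rewrite Cmod_mult, Cmod_pow.
        apply Rmult_le_compat; auto using Cmod_ge_0, pow_le.
        apply pow_incr; lra. }
      replace (M * / (1 - rho) * (rho ^ N - rho ^ S m)) with
        (M * / (1 - rho) * (rho ^ N - rho ^ m) + M * rho ^ m) by (simpl; field; lra).
      lra. }
    assert (0 <= rho ^ n) by (apply pow_le; lra).
    assert (0 < / (1 - rho)) by (apply Rinv_0_lt_compat; lra).
    assert (0 <= M * / (1 - rho)) by nra. nra.
Qed.

Lemma psum_ext (x y : nat -> C) (z : C) : (forall n, x n = y n) -> psum x z = psum y z.
Proof.
  intros H. replace y with x; auto.
  now apply functional_extensionality.
Qed.

Lemma psum_lin (x y : nat -> C) (a : C) (M K : R) (z : C) :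
  (forall n, Cmod (x n) <= M) -> (forall n, Cmod (y n) <= K) -> Cmod z < 1 ->
  psum (fun n => x n + a * y n)%C z = (psum x z + a * psum y z)%C.
Proof.
  intros Hx Hy Hz.
  apply clim_unique with (csum (fun n => (x n + a * y n) * z ^ n)%C).
  - apply psum_correct with (M + Cmod a * K); auto.
    intros n. apply Rle_trans with (1 := Cmod_triangle _ _). rewrite Cmod_mult.
    specialize (Hx n); specialize (Hy n). pose proof (Cmod_ge_0 a). nra.
  - apply clim_ext with (fun N => csum (fun n => x n * z ^ n)%C N
        + a * csum (fun n => y n * z ^ n)%C N)%C.
    + intros N. rewrite <- csum_scal, <- csum_plus. apply csum_ext; intros; ring.
    + apply clim_plus; [| apply clim_scal]; eapply psum_correct; eauto.
Qed.

Lemma psum_geom (a x z : C) : Cmod x < 1 -> Cmod z < 1 ->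
  psum (fun n => a * x ^ n)%C z = (a / (1 - x * z))%C.
Proof.
  intros Hx Hz.
  pose proof (Cmod_mult_lt_1 x z Hx Hz) as Hxz.
  pose proof (one_minus_neq_0 _ Hxz) as Hne.
  apply clim_unique with (csum (fun n => a * x ^ n * z ^ n)%C).
  - apply psum_correct with (Cmod a); auto. intros n. rewrite Cmod_mult, Cmod_pow.
    assert (Cmod x ^ n <= 1 ^ n)
      by (apply pow_incr; split; [apply Cmod_ge_0 | lra]).
    rewrite pow1 in *. pose proof (Cmod_ge_0 a). nra.
  - apply clim_ext with (fun n => a / (1 - x * z) + (- a / (1 - x * z)) * (x * z) ^ n)%C.
    + intros n. induction n; cbn [csum].
      * simpl. field; auto.
      * rewrite <- IHn. rewrite !Cpow_mult_l, !Cpow_S. field; auto.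
    + pose proof (clim_plus _ _ _ _ (clim_const (a / (1 - x * z))%C)
        (clim_geom (- a / (1 - x * z))%C _ Hxz)) as H.
      rewrite Cplus_0_r in H. exact H.
Qed.

(** The convolution of [x] with the powers of [rho], shifted by one.  Applied once and
    twice to these powers it dominates the derivatives and the second-order Taylor
    remainders of the monomials on the disk of radius [rho]; the recursive form
    is the one in which these quantities arise. *)
Fixpoint maj (rho : R) (x : nat -> R) (n : nat) : R :=
  match n with O => 0 | S m => rho * maj rho x m + x m end.

Lemma maj_nonneg (rho : R) (x : nat -> R) (n : nat) :
  0 <= rho -> (forall k, 0 <= x k) -> 0 <= maj rho x n.
Proof. intros Hr Hx; induction n; simpl; [lra | specialize (Hx n); nra]. Qed.

(** Summing the recursion bounds [(1 - rho)] times the sum of the majorants. *)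
Lemma maj_sum_le (rho : R) (x : nat -> R) (K : R) (N : nat) :
  0 <= rho < 1 -> (forall k, 0 <= x k) -> (forall n, rsum x n <= K) ->
  rsum (maj rho x) N <= K * / (1 - rho).
Proof.
  intros Hr Hx HK.
  assert (Hm : forall k, 0 <= maj rho x k) by (intros; apply maj_nonneg; auto; lra).
  assert (H : rsum (maj rho x) (S N) = rho * rsum (maj rho x) N + rsum x N).
  { rewrite rsum_shift. simpl maj. rewrite rsum_plus, rsum_scal. ring. }
  assert (H1 : rsum (maj rho x) N <= rsum (maj rho x) (S N))
    by (apply rsum_mono; auto).
  specialize (HK N).
  apply Rmult_le_reg_r with (1 - rho); [lra|].
  replace (K * / (1 - rho) * (1 - rho)) with K by (field; lra). lra.
Qed.

(** The derivative [n z^(n-1)] of the monomial, in the form given by the Leibniz rule. *)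
Fixpoint dpow (z : C) (n : nat) : C :=
  match n with O => RtoC 0 | S m => (z * dpow z m + z ^ m)%C end.

Lemma Cmod_dpow_le (rho : R) (z : C) (n : nat) : Cmod z <= rho ->
  Cmod (dpow z n) <= maj rho (fun k => rho ^ k) n.
Proof.
  intros Hz. pose proof (Cmod_ge_0 z). induction n; simpl.
  - rewrite Cmod_0; lra.
  - apply Rle_trans with (1 := Cmod_triangle _ _). rewrite Cmod_mult, Cmod_pow.
    apply Rplus_le_compat.
    + apply Rmult_le_compat; auto using Cmod_ge_0.
    + apply pow_incr; lra.
Qed.

Lemma pow_taylor_le (rho : R) (u z : C) (n : nat) : Cmod z <= rho -> Cmod u <= rho ->
  Cmod (u ^ n - z ^ n - (u - z) * dpow z n)%C
    <= maj rho (maj rho (fun k => rho ^ k)) n * Cmod (u - z)%C ^ 2.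
Proof.
  intros Hz Hu. pose proof (Cmod_ge_0 u). induction n; cbn [maj].
  - simpl. replace (1 - 1 - (u - z) * 0)%C with (RtoC 0) by ring. rewrite Cmod_0. lra.
  - replace (u ^ S n - z ^ S n - (u - z) * dpow z (S n))%C
      with (u * (u ^ n - z ^ n - (u - z) * dpow z n) + dpow z n * ((u - z) * (u - z)))%C
      by (simpl; ring).
    apply Rle_trans with (1 := Cmod_triangle _ _). rewrite !Cmod_mult.
    pose proof (Cmod_dpow_le rho z n Hz).
    rewrite Rmult_plus_distr_r. apply Rplus_le_compat.
    + rewrite Rmult_assoc. apply Rmult_le_compat; auto using Cmod_ge_0.
    + replace (Cmod (u - z) ^ 2) with (Cmod (u - z)%C * Cmod (u - z)%C) by ring.
      apply Rmult_le_compat_r; auto. pose proof (Cmod_ge_0 (u - z)%C). nra.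
Qed.

(** Termwise differentiation: the second-order remainders of the monomials are
    summable with a bound quadratic in the increment. *)
Lemma psum_cdiff (y : nat -> C) (M : R) (z : C) :
  (forall n, Cmod (y n) <= M) -> Cmod z < 1 -> exists l, cdiff (psum y) z l.
Proof.
  intros HM Hz. pose proof (Cmod_ge_0 z) as Hz0.
  assert (HM0 : 0 <= M) by (pose proof (Cmod_ge_0 (y O)); specialize (HM O); lra).
  set (rho := (1 + Cmod z) / 2).
  assert (Hr : 0 <= rho < 1) by (unfold rho; lra).
  assert (Hzr : Cmod z <= rho) by (unfold rho; lra).
  set (p := fun k => rho ^ k).
  assert (Hp : forall k, 0 <= p k) by (intros; apply pow_le; lra).
  assert (Hd : forall k, 0 <= maj rho p k) by (intros; apply maj_nonneg; auto; lra).
  assert (Sd : forall n, rsum (maj rho p) n <= / (1 - rho) * / (1 - rho)).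
  { intros; apply maj_sum_le; auto. intros; now apply rsum_geom_le. }
  set (K := / (1 - rho) * / (1 - rho) * / (1 - rho)).
  assert (Se : forall n, rsum (maj rho (maj rho p)) n <= K).
  { intros; apply maj_sum_le; auto. }
  assert (HK : 0 < K).
  { assert (0 < / (1 - rho)) by (apply Rinv_0_lt_compat; lra).
    unfold K. repeat apply Rmult_lt_0_compat; auto. }
  destruct (csum_abs_cv (fun n => y n * dpow z n)%C (M * (/ (1 - rho) * / (1 - rho))))
    as [l Hl].
  { intros N. apply Rle_trans with (rsum (fun n => M * maj rho p n) N).
    - apply rsum_le. intros k _. rewrite Cmod_mult.
      apply Rmult_le_compat; auto using Cmod_ge_0. now apply Cmod_dpow_le.
    - rewrite rsum_scal. apply Rmult_le_compat_l; auto. }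
  exists l. intros eps Heps.
  exists (Rmin ((1 - Cmod z) / 2) (eps / (M * K + 1))).
  assert (0 < M * K + 1) by nra.
  split. { apply Rmin_glb_lt; [lra | now apply Rdiv_lt_0_compat]. }
  intros u Hu.
  pose proof (Rmin_l ((1 - Cmod z) / 2) (eps / (M * K + 1))).
  pose proof (Rmin_r ((1 - Cmod z) / 2) (eps / (M * K + 1))).
  assert (Hur : Cmod u <= rho).
  { pose proof (Cmod_triangle (u - z) z) as T.
    replace (u - z + z)%C with u in T by ring. unfold rho. lra. }
  set (D := Cmod (u - z)%C) in *.
  assert (HD : 0 <= D) by apply Cmod_ge_0.
  apply Rle_trans with (M * (K * D ^ 2)).
  - apply clim_le with (fun N => csum (fun n => y n * u ^ n)%C N
        + (-1) * csum (fun n => y n * z ^ n)%C N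
        + (- (u - z)) * csum (fun n => y n * dpow z n)%C N)%C O.
    + replace (psum y u - psum y z - (u - z) * l)%C
        with (psum y u + (-1) * psum y z + (- (u - z)) * l)%C by ring.
      apply clim_plus; [apply clim_plus|]; try apply clim_scal; auto;
        apply psum_correct with M; auto; lra.
    + intros N _. rewrite <- !csum_scal, <- !csum_plus.
      apply Rle_trans with (1 := Cmod_csum_le _ _).
      apply Rle_trans with (rsum (fun n => M * D ^ 2 * maj rho (maj rho p) n) N).
      * apply rsum_le. intros n _.
        replace (y n * u ^ n + -1 * (y n * z ^ n) + - (u - z) * (y n * dpow z n))%C
          with (y n * (u ^ n - z ^ n - (u - z) * dpow z n))%C by ring.
        rewrite Cmod_mult.
        replace (M * D ^ 2 * maj rho (maj rho p) n)
          with (M * (maj rho (maj rho p) n * D ^ 2)) by ring.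
        apply Rmult_le_compat; auto using Cmod_ge_0. now apply pow_taylor_le.
      * rewrite rsum_scal.
        replace (M * (K * D ^ 2)) with (M * D ^ 2 * K) by ring.
        apply Rmult_le_compat_l; auto. pose proof (pow2_ge_0 D). nra.
  - assert (D * (M * K + 1) <= eps).
    { apply Rle_trans with (eps / (M * K + 1) * (M * K + 1)).
      - apply Rmult_le_compat_r; lra.
      - right; field; lra. }
    nra.
Qed.

(** * Goursat's theorem for closed forms on rectangles *)

(** The common value [m] of [dP/dt] and [dQ/ds] is what makes the form [P ds + Q dt]
    closed at the point. *)
Definition closed_form (P Q : R -> R -> R) (s t : R) : Prop :=
  exists p m q, differentiable_pt_lim P s t p m /\ differentiable_pt_lim Q s t m q.

Definition closed_on (P Q : R -> R -> R) (x y h k : R) : Prop :=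
  forall s t, x <= s <= x + h -> y <= t <= y + k -> closed_form P Q s t.

(** The counterclockwise integral of [P ds + Q dt] along the boundary of the rectangle
    with lower left corner [(x, y)] and sides [h] and [k]. *)
Definition bdry (P Q : R -> R -> R) (x y h k : R) : R :=
  RInt (fun s => P s y - P s (y + k)) x (x + h)
  + RInt (fun t => Q (x + h) t - Q x t) y (y + k).

Lemma closed_on_sub (P Q : R -> R -> R) (x y h k x' y' h' k' : R) :
  closed_on P Q x y h k -> x <= x' -> x' + h' <= x + h -> y <= y' -> y' + k' <= y + k ->
  closed_on P Q x' y' h' k'.
Proof. intros H; intros; intros s t Hs Ht; apply H; lra. Qed.

Lemma derivable_pt_lim_cst (c t : R) : derivable_pt_lim (fun _ => c) t 0.
Proof. exact (derivable_pt_lim_const c t). Qed.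

Lemma derivable_pt_lim_ident (t : R) : derivable_pt_lim (fun u => u) t 1.
Proof. exact (derivable_pt_lim_id t). Qed.

Lemma continuous_slice_l (P : R -> R -> R) (s t p m : R) :
  differentiable_pt_lim P s t p m -> continuous (fun u => P u t) s.
Proof.
  intros H. apply continuous_of_is_derive with (p * 1 + m * 0). apply is_derive_Reals.
  apply (derivable_pt_lim_comp_2d P (fun u => u) (fun _ => t)); auto.
  apply derivable_pt_lim_ident. apply derivable_pt_lim_cst.
Qed.

Lemma continuous_slice_r (P : R -> R -> R) (s t p m : R) :
  differentiable_pt_lim P s t p m -> continuous (fun v => P s v) t.
Proof.
  intros H. apply continuous_of_is_derive with (p * 0 + m * 1). apply is_derive_Reals.
  apply (derivable_pt_lim_comp_2d P (fun _ => s) (fun v => v)); auto.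
  apply derivable_pt_lim_cst. apply derivable_pt_lim_ident.
Qed.

Lemma ex_RInt_segment (u : R -> R) (a b : R) : a <= b ->
  (forall t, a <= t <= b -> continuous u t) -> ex_RInt u a b.
Proof.
  intros Hab H. apply (@ex_RInt_continuous R_CompleteNormedModule).
  intros z. rewrite Rmin_left, Rmax_right by auto. apply H.
Qed.

Lemma ex_RInt_P (P Q : R -> R -> R) (x y h k v : R) : 0 <= h -> y <= v <= y + k ->
  closed_on P Q x y h k -> ex_RInt (fun s => P s v) x (x + h).
Proof.
  intros Hh Hv H. apply ex_RInt_segment; [lra|]. intros s Hs.
  destruct (H s v) as (p & m & q & HP & _); auto. now apply continuous_slice_l with p m.
Qed.

Lemma ex_RInt_Q (P Q : R -> R -> R) (x y h k u : R) : 0 <= k -> x <= u <= x + h ->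
  closed_on P Q x y h k -> ex_RInt (fun t => Q u t) y (y + k).
Proof.
  intros Hk Hu H. apply ex_RInt_segment; [lra|]. intros t Ht.
  destruct (H u t) as (p & m & q & _ & HQ); auto. now apply continuous_slice_r with m q.
Qed.

Lemma RInt_sub (f g : R -> R) (a b : R) : ex_RInt f a b -> ex_RInt g a b ->
  RInt (fun t => f t - g t) a b = RInt f a b - RInt g a b.
Proof. intros Hf Hg. exact (RInt_minus f g a b Hf Hg). Qed.

Lemma RInt_join (f : R -> R) (a b c : R) : ex_RInt f a b -> ex_RInt f b c ->
  RInt f a c = RInt f a b + RInt f b c.
Proof. intros H1 H2. symmetry. exact (RInt_Chasles f a b c H1 H2). Qed.

Lemma bdry_alt (P Q : R -> R -> R) (x y h k : R) : 0 <= h -> 0 <= k ->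
  closed_on P Q x y h k ->
  bdry P Q x y h k = RInt (fun s => P s y) x (x + h) - RInt (fun s => P s (y + k)) x (x + h)
    + (RInt (fun t => Q (x + h) t) y (y + k) - RInt (fun t => Q x t) y (y + k)).
Proof.
  intros Hh Hk H. unfold bdry.
  rewrite (RInt_sub (fun s => P s y)), (RInt_sub (fun t => Q (x + h) t)).
  - reflexivity.
  - apply ex_RInt_Q with P x h; auto; lra.
  - apply ex_RInt_Q with P x h; auto; lra.
  - apply ex_RInt_P with Q y k; auto; lra.
  - apply ex_RInt_P with Q y k; auto; lra.
Qed.

Lemma bdry_split_l (P Q : R -> R -> R) (x y h k : R) : 0 <= h -> 0 <= k ->
  closed_on P Q x y (h + h) k ->
  bdry P Q x y (h + h) k = bdry P Q x y h k + bdry P Q (x + h) y h k.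
Proof.
  intros Hh Hk H.
  assert (H1 : closed_on P Q x y h k) by (apply closed_on_sub with (1 := H); lra).
  assert (H2 : closed_on P Q (x + h) y h k) by (apply closed_on_sub with (1 := H); lra).
  rewrite !bdry_alt by (auto; lra).
  replace (x + (h + h)) with (x + h + h) by ring.
  rewrite (RInt_join (fun s => P s y) x (x + h)),
          (RInt_join (fun s => P s (y + k)) x (x + h)).
  - ring.
  - apply ex_RInt_P with Q y k; auto; lra.
  - apply ex_RInt_P with Q y k; auto; lra.
  - apply ex_RInt_P with Q y k; auto; lra.
  - apply ex_RInt_P with Q y k; auto; lra.
Qed.

Lemma bdry_split_r (P Q : R -> R -> R) (x y h k : R) : 0 <= h -> 0 <= k ->
  closed_on P Q x y h (k + k) ->
  bdry P Q x y h (k + k) = bdry P Q x y h k + bdry P Q x (y + k) h k.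
Proof.
  intros Hh Hk H.
  assert (H1 : closed_on P Q x y h k) by (apply closed_on_sub with (1 := H); lra).
  assert (H2 : closed_on P Q x (y + k) h k) by (apply closed_on_sub with (1 := H); lra).
  rewrite !bdry_alt by (auto; lra).
  replace (y + (k + k)) with (y + k + k) by ring.
  rewrite (RInt_join (fun t => Q (x + h) t) y (y + k)),
          (RInt_join (fun t => Q x t) y (y + k)).
  - ring.
  - apply ex_RInt_Q with P x h; auto; lra.
  - apply ex_RInt_Q with P x h; auto; lra.
  - apply ex_RInt_Q with P x h; auto; lra.
  - apply ex_RInt_Q with P x h; auto; lra.
Qed.

Lemma RInt_near_const (f : R -> R) (a h c M : R) : 0 <= h -> ex_RInt f a (a + h) ->
  (forall t, a <= t <= a + h -> Rabs (f t - c) <= M) ->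
  Rabs (RInt f a (a + h) - c * h) <= h * M.
Proof.
  intros Hh Hf H.
  assert (Hc : ex_RInt (fun _ : R => c) a (a + h)) by apply ex_RInt_const.
  replace (RInt f a (a + h) - c * h) with (RInt (fun t => f t - c) a (a + h)).
  - replace (h * M) with ((a + h - a) * M) by ring.
    apply abs_RInt_le_const; auto; [lra|].
    exact (ex_RInt_minus f (fun _ => c) a (a + h) Hf Hc).
  - rewrite RInt_sub, RInt_const by auto. unfold scal; simpl; unfold mult; simpl. ring.
Qed.

(** The linear parts of [P] and [Q] at the point integrate to zero around the rectangle
    because the form is closed there, so only the remainders contribute. *)
Lemma bdry_small (P Q : R -> R -> R) (s t eps : R) : 0 < eps -> closed_form P Q s t ->
  exists d, 0 < d /\ forall x y h k, 0 <= h < d -> 0 <= k < d ->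
    x <= s <= x + h -> y <= t <= y + k -> closed_on P Q x y h k ->
    Rabs (bdry P Q x y h k) <= eps * (h + k) ^ 2.
Proof.
  intros Heps (p & m & q & HP & HQ).
  assert (He : 0 < eps / 2) by lra.
  destruct (HP (mkposreal _ He)) as [d1 H1].
  destruct (HQ (mkposreal _ He)) as [d2 H2]. simpl in H1, H2.
  exists (Rmin d1 d2). split; [apply Rmin_glb_lt; apply cond_pos|].
  pose proof (Rmin_l d1 d2). pose proof (Rmin_r d1 d2).
  intros x y h k Hh Hk Hs Ht Hcl.
  assert (Hin : forall u v, x <= u <= x + h -> y <= v <= y + k ->
     Rabs (u - s) <= h /\ Rabs (v - t) <= k /\
     Rmax (Rabs (u - s)) (Rabs (v - t)) <= h + k).
  { intros u v Hu Hv.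
    assert (Rabs (u - s) <= h) by (apply Rabs_le; lra).
    assert (Rabs (v - t) <= k) by (apply Rabs_le; lra).
    repeat split; auto. apply Rmax_lub; lra. }
  assert (RP : forall u v, x <= u <= x + h -> y <= v <= y + k ->
     Rabs (P u v - P s t - (p * (u - s) + m * (v - t))) <= eps / 2 * (h + k)).
  { intros u v Hu Hv. destruct (Hin u v Hu Hv) as (A1 & A2 & A3).
    apply Rle_trans with (1 := H1 u v ltac:(lra) ltac:(lra)).
    apply Rmult_le_compat_l; lra. }
  assert (RQ : forall u v, x <= u <= x + h -> y <= v <= y + k ->
     Rabs (Q u v - Q s t - (m * (u - s) + q * (v - t))) <= eps / 2 * (h + k)).
  { intros u v Hu Hv. destruct (Hin u v Hu Hv) as (A1 & A2 & A3).
    apply Rle_trans with (1 := H2 u v ltac:(lra) ltac:(lra)).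
    apply Rmult_le_compat_l; lra. }
  set (I := RInt (fun u => P u y - P u (y + k)) x (x + h)).
  set (J := RInt (fun v => Q (x + h) v - Q x v) y (y + k)).
  assert (HI : Rabs (I - (- (m * k)) * h) <= h * (eps * (h + k))).
  { apply RInt_near_const; [lra | |].
    - apply (@ex_RInt_minus R_NormedModule (fun u => P u y) (fun u => P u (y + k)));
        apply ex_RInt_P with Q y k; auto; lra.
    - intros u Hu.
      pose proof (RP u y Hu ltac:(lra)) as B1. pose proof (RP u (y + k) Hu ltac:(lra)) as B2.
      apply Rabs_le_between in B1, B2. apply Rabs_le. lra. }
  assert (HJ : Rabs (J - m * h * k) <= k * (eps * (h + k))).
  { apply RInt_near_const; [lra | |].
    - apply (@ex_RInt_minus R_NormedModule (fun v => Q (x + h) v) (fun v => Q x v));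
        apply ex_RInt_Q with P x h; auto; lra.
    - intros v Hv.
      pose proof (RQ (x + h) v ltac:(lra) Hv) as B1. pose proof (RQ x v ltac:(lra) Hv) as B2.
      apply Rabs_le_between in B1, B2. apply Rabs_le. lra. }
  unfold bdry. fold I J.
  apply Rabs_le_between in HI, HJ. apply Rabs_le. nra.
Qed.

Lemma nested_intervals (a b : nat -> R) :
  (forall n, a n <= a (S n)) -> (forall n, b (S n) <= b n) -> (forall n, a n <= b n) ->
  exists x, forall n, a n <= x <= b n.
Proof.
  intros Ha Hb Hab.
  assert (Ma : forall n m, (n <= m)%nat -> a n <= a m).
  { intros n m H; induction H; [lra | specialize (Ha m); lra]. }
  assert (Mb : forall n m, (n <= m)%nat -> b m <= b n).
  { intros n m H; induction H; [lra | specialize (Hb m); lra]. }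
  assert (Hmn : forall n m, a n <= b m).
  { intros n m. apply Rle_trans with (a (max n m)).
    - apply Ma, Nat.le_max_l.
    - apply Rle_trans with (1 := Hab _). apply Mb, Nat.le_max_r. }
  destruct (completeness (fun v => exists n, v = a n)) as [x [Hx1 Hx2]].
  - exists (b O). intros v [n ->]. apply Hmn.
  - now exists (a O), O.
  - exists x. intros n. split.
    + apply Hx1. now exists n.
    + apply Hx2. intros v [j ->]. apply Hmn.
Qed.

(** Goursat's subdivision: a rectangle whose boundary integral is too large compared
    with its size contains a quarter with the same defect, and at the point to which
    the nested quarters shrink this contradicts [bdry_small]. *)
Lemma bdry_le (P Q : R -> R -> R) (x0 y0 h0 k0 eps : R) : 0 <= h0 -> 0 <= k0 -> 0 < eps ->
  closed_on P Q x0 y0 h0 k0 -> Rabs (bdry P Q x0 y0 h0 k0) <= eps * (h0 + k0) ^ 2.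
Proof.
  intros Hh0 Hk0 Heps Hcl.
  destruct (Rle_lt_dec (Rabs (bdry P Q x0 y0 h0 k0)) (eps * (h0 + k0) ^ 2)) as [|Hbad]; auto.
  exfalso.
  set (h := fun n : nat => h0 / 2 ^ n). set (k := fun n : nat => k0 / 2 ^ n).
  assert (p2 : forall n : nat, 0 < 2 ^ n) by (intros; apply pow_lt; lra).
  assert (Hh : forall n, 0 <= h n) by (intros; now apply Rdiv_le_0_compat).
  assert (Hk : forall n, 0 <= k n) by (intros; now apply Rdiv_le_0_compat).
  assert (hS : forall n, h n = h (S n) + h (S n)).
  { intros n. unfold h; simpl. specialize (p2 n). field. lra. }
  assert (kS : forall n, k n = k (S n) + k (S n)).
  { intros n. unfold k; simpl. specialize (p2 n). field. lra. }
  set (bad := fun (n : nat) (c : R * R) =>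
    x0 <= fst c /\ fst c + h n <= x0 + h0 /\ y0 <= snd c /\ snd c + k n <= y0 + k0 /\
    eps * (h n + k n) ^ 2 < Rabs (bdry P Q (fst c) (snd c) (h n) (k n))).
  set (next := fun (n : nat) (c c' : R * R) => bad (S n) c' /\
    fst c <= fst c' /\ fst c' + h (S n) <= fst c + h n /\
    snd c <= snd c' /\ snd c' + k (S n) <= snd c + k n).
  assert (step : forall n c, bad n c -> exists c', next n c c').
  { intros n [x y] (B1 & B2 & B3 & B4 & B5); simpl in *.
    assert (Hc : closed_on P Q x y (h n) (k n)) by (apply closed_on_sub with (1 := Hcl); auto).
    pose proof (Hh (S n)). pose proof (Hk (S n)).
    rewrite hS, kS in B5. rewrite hS, kS in Hc. rewrite hS in B2. rewrite kS in B4.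
    set (H2 := h (S n)) in *. set (K2 := k (S n)) in *.
    assert (E : bdry P Q x y (H2 + H2) (K2 + K2) =
       bdry P Q x y H2 K2 + bdry P Q x (y + K2) H2 K2
       + (bdry P Q (x + H2) y H2 K2 + bdry P Q (x + H2) (y + K2) H2 K2)).
    { rewrite bdry_split_l, !bdry_split_r by
        (auto; try lra; apply closed_on_sub with (1 := Hc); lra). ring. }
    rewrite E in B5.
    assert (Hsum : Rabs (bdry P Q x y H2 K2 + bdry P Q x (y + K2) H2 K2
       + (bdry P Q (x + H2) y H2 K2 + bdry P Q (x + H2) (y + K2) H2 K2)) <=
       Rabs (bdry P Q x y H2 K2) + Rabs (bdry P Q x (y + K2) H2 K2)
       + (Rabs (bdry P Q (x + H2) y H2 K2) + Rabs (bdry P Q (x + H2) (y + K2) H2 K2))).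
    { apply Rle_trans with (1 := Rabs_triang _ _).
      apply Rplus_le_compat; apply Rabs_triang. }
    replace (eps * (H2 + H2 + (K2 + K2)) ^ 2) with (4 * (eps * (H2 + K2) ^ 2)) in B5 by ring.
    unfold next, bad. rewrite (hS n), (kS n). fold H2 K2.
    destruct (Rlt_dec (eps * (H2 + K2) ^ 2) (Rabs (bdry P Q x y H2 K2))).
    { exists (x, y); cbn [fst snd]; repeat split; auto; lra. }
    destruct (Rlt_dec (eps * (H2 + K2) ^ 2) (Rabs (bdry P Q x (y + K2) H2 K2))).
    { exists (x, y + K2); cbn [fst snd]; repeat split; auto; lra. }
    destruct (Rlt_dec (eps * (H2 + K2) ^ 2) (Rabs (bdry P Q (x + H2) y H2 K2))).
    { exists (x + H2, y); cbn [fst snd]; repeat split; auto; lra. }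
    exists (x + H2, y + K2); cbn [fst snd]; repeat split; auto; lra. }
  set (c := fix c (n : nat) : R * R := match n with
     | O => (x0, y0)
     | S m => epsilon (inhabits (x0, y0)) (next m (c m)) end).
  assert (Hb : forall n, bad n (c n)).
  { intros n; induction n.
    - unfold bad, h, k; simpl. rewrite !Rdiv_1_r. repeat split; auto; lra.
    - simpl. apply (epsilon_spec (inhabits (x0, y0)) (next n (c n))). now apply step. }
  assert (Hn : forall n, next n (c n) (c (S n))).
  { intros n. simpl. apply epsilon_spec. apply step, Hb. }
  destruct (nested_intervals (fun n => fst (c n)) (fun n => fst (c n) + h n)) as [s Hs].
  { intros n; apply Hn. } { intros n; apply Hn. } { intros n; specialize (Hh n); lra. }
  destruct (nested_intervals (fun n => snd (c n)) (fun n => snd (c n) + k n)) as [t Ht].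
  { intros n; apply Hn. } { intros n; apply Hn. } { intros n; specialize (Hk n); lra. }
  cbv beta in Hs, Ht.
  assert (Hst : closed_form P Q s t).
  { destruct (Hb O) as (B1 & B2 & B3 & B4 & _). specialize (Hs O); specialize (Ht O).
    apply Hcl; lra. }
  destruct (bdry_small P Q s t eps Heps Hst) as [d [Hd Hsmall]].
  assert (Hlim : forall v, is_lim_seq (fun n => v / 2 ^ n) 0).
  { intros v. apply is_lim_seq_ext with (fun n => v * (/ 2) ^ n).
    { intros n. unfold Rdiv. now rewrite pow_inv. }
    replace (Finite 0) with (Rbar_mult v 0) by (simpl; f_equal; ring).
    apply is_lim_seq_scal_l, is_lim_seq_geom. rewrite Rabs_pos_eq; lra. }
  pose proof (Hlim h0) as L1. pose proof (Hlim k0) as L2.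
  apply is_lim_seq_spec in L1, L2. simpl in L1, L2.
  destruct (L1 (mkposreal d Hd)) as [N1 HN1]. destruct (L2 (mkposreal d Hd)) as [N2 HN2].
  set (n := max N1 N2).
  specialize (HN1 n (Nat.le_max_l _ _)). specialize (HN2 n (Nat.le_max_r _ _)).
  simpl in HN1, HN2. apply Rabs_def2 in HN1, HN2.
  fold (h n) in HN1. fold (k n) in HN2.
  destruct (Hb n) as (B1 & B2 & B3 & B4 & B5).
  assert (Rabs (bdry P Q (fst (c n)) (snd (c n)) (h n) (k n)) <= eps * (h n + k n) ^ 2).
  { apply Hsmall; auto; try lra.
    - specialize (Hh n); lra.
    - specialize (Hk n); lra.
    - apply closed_on_sub with (1 := Hcl); lra. }
  lra.
Qed.

Lemma bdry_zero (P Q : R -> R -> R) (x y h k : R) : 0 <= h -> 0 <= k ->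
  closed_on P Q x y h k -> bdry P Q x y h k = 0.
Proof.
  intros Hh Hk H.
  destruct (Req_dec (bdry P Q x y h k) 0) as [|Hne]; auto. exfalso.
  apply Rabs_pos_lt in Hne. set (B := Rabs (bdry P Q x y h k)) in *.
  pose proof (pow2_ge_0 (h + k)) as H2.
  (* The added [1] covers the degenerate rectangle; any [eps] making the bound of
     [bdry_le] smaller than [B] would do. *)
  pose proof (bdry_le P Q x y h k (B / (2 * ((h + k) ^ 2 + 1))) Hh Hk) as L. fold B in L.
  assert (0 < B / (2 * ((h + k) ^ 2 + 1))) by (apply Rdiv_lt_0_compat; lra).
  specialize (L ltac:(auto) H).
  assert (B / (2 * ((h + k) ^ 2 + 1)) * (h + k) ^ 2 < B); [|lra].
  apply Rmult_lt_reg_r with (2 * ((h + k) ^ 2 + 1)); [lra|].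
  replace (B / (2 * ((h + k) ^ 2 + 1)) * (h + k) ^ 2 * (2 * ((h + k) ^ 2 + 1)))
    with (B * (h + k) ^ 2) by (field; lra).
  nra.
Qed.

(** By periodicity the two horizontal sides cancel. *)
Lemma periodic_mean_const (P Q : R -> R -> R) (s1 s2 : R) : s1 <= s2 ->
  (forall s t, s <= s2 -> closed_form P Q s t) ->
  (forall s, P s 0 = P s (2 * PI)) ->
  mean (fun t => Q s1 t) = mean (fun t => Q s2 t).
Proof.
  intros Hs Hcl Hper. pose proof two_PI_pos.
  assert (Hc : closed_on P Q s1 0 (s2 - s1) (2 * PI)).
  { intros s t Hs' Ht. apply Hcl. lra. }
  pose proof (bdry_zero P Q s1 0 (s2 - s1) (2 * PI) ltac:(lra) ltac:(lra) Hc) as Z.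
  rewrite bdry_alt in Z by (auto; lra).
  replace (s1 + (s2 - s1)) with s2 in Z by ring. rewrite Rplus_0_l in Z.
  rewrite (RInt_ext (fun s => P s 0) (fun s => P s (2 * PI))) in Z by auto.
  unfold mean. f_equal. lra.
Qed.

(** * Taylor coefficients of holomorphic functions on the disk *)

(** The Cauchy-Riemann equations for [U + i V] in the variable [s + i t]. *)
Definition holo (U V : R -> R -> R) (s t : R) : Prop :=
  exists a b, differentiable_pt_lim U s t a (- b) /\ differentiable_pt_lim V s t b a.

Lemma dpl_eq (f : R -> R -> R) (s t a b a' b' : R) : a = a' -> b = b' ->
  differentiable_pt_lim f s t a b -> differentiable_pt_lim f s t a' b'.
Proof. now intros -> ->. Qed.

Lemma dpl_snd (s t : R) : differentiable_pt_lim (fun _ v => v) s t 0 1.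
Proof.
  intros eps. exists eps. intros u v _ _.
  replace (v - t - (0 * (u - s) + 1 * (v - t))) with 0 by ring. rewrite Rabs_R0.
  apply Rmult_le_pos; [left; apply cond_pos|].
  apply Rle_trans with (2 := Rmax_l _ _). apply Rabs_pos.
Qed.

Lemma dpl_add (x y : R) : differentiable_pt_lim (fun u v => u + v) x y 1 1.
Proof.
  intros eps. exists eps. intros u v _ _.
  replace (u + v - (x + y) - (1 * (u - x) + 1 * (v - y))) with 0 by ring. rewrite Rabs_R0.
  apply Rmult_le_pos; [left; apply cond_pos|].
  apply Rle_trans with (2 := Rmax_l _ _). apply Rabs_pos.
Qed.

Lemma dpl_mul (x y : R) : differentiable_pt_lim (fun u v => u * v) x y y x.
Proof.
  intros eps. exists eps. intros u v Hu Hv.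
  replace (u * v - x * y - (y * (u - x) + x * (v - y))) with ((u - x) * (v - y)) by ring.
  rewrite Rabs_mult. apply Rmult_le_compat; try apply Rabs_pos; [lra | apply Rmax_r].
Qed.

Lemma dpl_plus (f g : R -> R -> R) (s t a b c d : R) :
  differentiable_pt_lim f s t a b -> differentiable_pt_lim g s t c d ->
  differentiable_pt_lim (fun u v => f u v + g u v) s t (a + c) (b + d).
Proof.
  intros Hf Hg.
  pose proof (differentiable_pt_lim_comp _ f g s t _ _ _ _ _ _ (dpl_add _ _) Hf Hg) as H.
  revert H; apply dpl_eq; ring.
Qed.

Lemma dpl_mult (f g : R -> R -> R) (s t a b c d : R) :
  differentiable_pt_lim f s t a b -> differentiable_pt_lim g s t c d ->
  differentiable_pt_lim (fun u v => f u v * g u v) s t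
    (g s t * a + f s t * c) (g s t * b + f s t * d).
Proof.
  intros Hf Hg.
  exact (differentiable_pt_lim_comp _ f g s t _ _ _ _ _ _ (dpl_mul _ _) Hf Hg).
Qed.

Lemma dpl_opp (f : R -> R -> R) (s t a b : R) :
  differentiable_pt_lim f s t a b ->
  differentiable_pt_lim (fun u v => - f u v) s t (- a) (- b).
Proof.
  intros Hf. pose proof (differentiable_pt_lim_proj1_0 (fun _ => -1) s t 0
    (derivable_pt_lim_cst _ _)) as Hc.
  pose proof (dpl_mult _ f s t _ _ _ _ Hc Hf) as H. cbv beta in H.
  apply differentiable_pt_lim_ext with (fun u v => -1 * f u v).
  - exists (mkposreal 1 Rlt_0_1). intros; ring.
  - revert H; apply dpl_eq; ring.
Qed.

Lemma dpl_separate (f g : R -> R) (s t a b : R) :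
  derivable_pt_lim f s a -> derivable_pt_lim g t b ->
  differentiable_pt_lim (fun u v => f u * g v) s t (a * g t) (f s * b).
Proof.
  intros Hf Hg.
  pose proof (differentiable_pt_lim_proj1_0 f s t a Hf) as H1.
  pose proof (differentiable_pt_lim_comp (fun u _ => g u) (fun _ v => v) (fun _ v => v) s t
    _ _ _ _ _ _ (differentiable_pt_lim_proj1_0 g t t b Hg) (dpl_snd s t) (dpl_snd s t)) as H2.
  pose proof (dpl_mult _ _ _ _ _ _ _ _ H1 H2) as H. cbv beta in H.
  revert H; apply dpl_eq; ring.
Qed.

Lemma holo_mult (U V A B : R -> R -> R) (s t : R) : holo U V s t -> holo A B s t ->
  holo (fun u v => U u v * A u v - V u v * B u v)
       (fun u v => U u v * B u v + V u v * A u v) s t.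
Proof.
  intros (a & b & HU & HV) (c & d & HA & HB).
  exists (A s t * a + U s t * c - (B s t * b + V s t * d)),
         (B s t * a + U s t * d + (A s t * b + V s t * c)).
  split.
  - pose proof (dpl_plus _ _ _ _ _ _ _ _ (dpl_mult _ _ _ _ _ _ _ _ HU HA)
      (dpl_opp _ _ _ _ _ (dpl_mult _ _ _ _ _ _ _ _ HV HB))) as H.
    revert H; apply dpl_eq; ring.
  - pose proof (dpl_plus _ _ _ _ _ _ _ _ (dpl_mult _ _ _ _ _ _ _ _ HU HB)
      (dpl_mult _ _ _ _ _ _ _ _ HV HA)) as H.
    revert H; apply dpl_eq; ring.
Qed.

(** If [U + i V] satisfies the Cauchy-Riemann equations, the forms [V ds + U dt] and
    [- U ds + V dt] are closed. *)
Lemma holo_mean_const (U V : R -> R -> R) (s1 s2 : R) : s1 <= s2 ->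
  (forall s t, s <= s2 -> holo U V s t) ->
  (forall s, U s 0 = U s (2 * PI)) -> (forall s, V s 0 = V s (2 * PI)) ->
  mean (fun t => U s1 t) = mean (fun t => U s2 t) /\
  mean (fun t => V s1 t) = mean (fun t => V s2 t).
Proof.
  intros Hs H HU HV. split.
  - apply periodic_mean_const with (fun s t => V s t); auto.
    intros s t Hst. destruct (H s t Hst) as (a & b & H1 & H2).
    now exists b, a, (- b).
  - apply periodic_mean_const with (fun s t => - U s t); auto.
    + intros s t Hst. destruct (H s t Hst) as (a & b & H1 & H2).
      exists (- a), b, a. split; auto.
      pose proof (dpl_opp _ _ _ _ _ H1) as H3. revert H3; apply dpl_eq; ring.
    + intros s. now rewrite HU.
Qed.

Definition diff_on_disk (F : C -> C) : Prop :=
  forall z, Cmod z < 1 -> exists l, cdiff F z l.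

Lemma Cmod_circle_pt (r t : R) : 0 <= r -> Cmod (circle_pt r t) = r.
Proof.
  intros Hr. unfold Cmod, circle_pt; simpl fst; simpl snd.
  replace ((r * cos t) ^ 2 + (r * sin t) ^ 2) with (r ^ 2).
  - now apply sqrt_pow2.
  - pose proof (sin2_cos2 t) as H. unfold Rsqr in H.
    replace ((r * cos t) ^ 2 + (r * sin t) ^ 2)
      with (r ^ 2 * (sin t * sin t + cos t * cos t)) by ring.
    rewrite H. ring.
Qed.

Definition on_circle (F : C -> C) (r t : R) : C := F (circle_pt r t).

Lemma tcont_on_circle (F : C -> C) (r : R) : diff_on_disk F -> 0 <= r < 1 ->
  tcont (on_circle F r).
Proof.
  intros HF Hr t.
  destruct (HF (circle_pt r t)) as [l Hl]. { rewrite Cmod_circle_pt; lra. }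
  assert (Hc : derivable_pt_lim (fun u => r * cos u) t (r * - sin t))
    by (apply is_derive_Reals; auto_derive; auto; ring).
  assert (Hs : derivable_pt_lim (fun u => r * sin u) t (r * cos t))
    by (apply is_derive_Reals; auto_derive; auto; ring).
  split; eapply continuous_of_is_derive; apply is_derive_Reals.
  - exact (derivable_pt_lim_comp_2d _ _ _ _ _ _ _ _ (cdiff_Re _ _ _ Hl) Hc Hs).
  - exact (derivable_pt_lim_comp_2d _ _ _ _ _ _ _ _ (cdiff_Im _ _ _ Hl) Hc Hs).
Qed.

Lemma exp_lt_1 (s : R) : s < 0 -> exp s < 1.
Proof. intros H. rewrite <- exp_0. now apply exp_increasing. Qed.

Lemma derivable_exp_mult (a s : R) :
  derivable_pt_lim (fun u => exp (a * u)) s (a * exp (a * s)).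
Proof. apply is_derive_Reals. auto_derive; auto. ring. Qed.

Lemma derivable_cos_mult (a t : R) :
  derivable_pt_lim (fun u => cos (a * u)) t (- a * sin (a * t)).
Proof. apply is_derive_Reals. auto_derive; auto. ring. Qed.

Lemma derivable_sin_mult (a t : R) :
  derivable_pt_lim (fun u => sin (a * u)) t (a * cos (a * t)).
Proof. apply is_derive_Reals. auto_derive; auto. ring. Qed.

(** In the logarithmic coordinates [z = e^(s+it)] circles become the vertical sides of
    rectangles, to which Goursat's theorem applies. *)
Lemma holo_comp_exp (F : C -> C) (s t : R) : diff_on_disk F -> s < 0 ->
  holo (fun u v => Re (F (circle_pt (exp u) v))) (fun u v => Im (F (circle_pt (exp u) v))) s t.
Proof.
  intros HF Hs.
  destruct (HF (circle_pt (exp s) t)) as [l Hl].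
  { pose proof (exp_pos s). rewrite Cmod_circle_pt by lra. now apply exp_lt_1. }
  pose proof (dpl_separate exp cos s t _ _ (derivable_pt_lim_exp s) (derivable_pt_lim_cos t))
    as HX.
  pose proof (dpl_separate exp sin s t _ _ (derivable_pt_lim_exp s) (derivable_pt_lim_sin t))
    as HY.
  pose proof (differentiable_pt_lim_comp _ _ _ _ _ _ _ _ _ _ _ (cdiff_Re _ _ _ Hl) HX HY)
    as HU.
  pose proof (differentiable_pt_lim_comp _ _ _ _ _ _ _ _ _ _ _ (cdiff_Im _ _ _ Hl) HX HY)
    as HV.
  exists (Re l * (exp s * cos t) - Im l * (exp s * sin t)),
         (Im l * (exp s * cos t) + Re l * (exp s * sin t)).
  split.
  - revert HU; apply dpl_eq; ring.
  - revert HV; apply dpl_eq; ring.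
Qed.

(** The factor [e^(-n(s+it))], that is [z^(-n)], which extracts the coefficient of
    order [n]. *)
Lemma holo_exp_mult (n : nat) (s t : R) :
  holo (fun u v => exp (- INR n * u) * cos (INR n * v))
       (fun u v => exp (- INR n * u) * - sin (INR n * v)) s t.
Proof.
  exists (- INR n * (exp (- INR n * s) * cos (INR n * t))),
         (INR n * (exp (- INR n * s) * sin (INR n * t))).
  split.
  - pose proof (dpl_separate _ _ s t _ _ (derivable_exp_mult (- INR n) s)
      (derivable_cos_mult (INR n) t)) as H.
    revert H; apply dpl_eq; ring.
  - assert (Hsin : derivable_pt_lim (fun u => - sin (INR n * u)) t (- (INR n * cos (INR n * t)))).
    { apply (derivable_pt_lim_opp (fun u => sin (INR n * u))). apply derivable_sin_mult. }
    pose proof (dpl_separate _ _ s t _ _ (derivable_exp_mult (- INR n) s) Hsin) as H.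
    revert H; apply dpl_eq; ring.
Qed.

Lemma circle_pt_period (r : R) : circle_pt r 0 = circle_pt r (2 * PI).
Proof. unfold circle_pt. now rewrite cos_2PI, sin_2PI, cos_0, sin_0. Qed.

Lemma fcoef_on_circle_scaled (F : C -> C) (n : nat) (s1 s2 : R) : diff_on_disk F ->
  s1 <= s2 -> s2 < 0 ->
  (RtoC (exp (- INR n * s1)) * fcoef (on_circle F (exp s1)) n)%C =
  (RtoC (exp (- INR n * s2)) * fcoef (on_circle F (exp s2)) n)%C.
Proof.
  intros HF H12 H2.
  set (U := fun u v => Re (F (circle_pt (exp u) v)) * (exp (- INR n * u) * cos (INR n * v))
    - Im (F (circle_pt (exp u) v)) * (exp (- INR n * u) * - sin (INR n * v))).
  set (V := fun u v => Re (F (circle_pt (exp u) v)) * (exp (- INR n * u) * - sin (INR n * v))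
    + Im (F (circle_pt (exp u) v)) * (exp (- INR n * u) * cos (INR n * v))).
  assert (E : forall s, s < 0 ->
    (RtoC (exp (- INR n * s)) * fcoef (on_circle F (exp s)) n)%C
    = (mean (fun t => U s t), mean (fun t => V s t))).
  { intros s Hs. unfold fcoef. rewrite <- cmean_scal.
    - apply C_ext; simpl; apply mean_ext; intros t; unfold U, V, on_circle, Re, Im;
        simpl; ring.
    - apply tcont_mult_chr, tcont_on_circle; auto. pose proof (exp_pos s).
      pose proof (exp_lt_1 s Hs). lra. }
  rewrite !E by lra.
  destruct (holo_mean_const U V s1 s2 H12) as [E1 E2].
  - intros s t Hs. apply holo_mult; [apply holo_comp_exp; auto; lra | apply holo_exp_mult].
  - intros s. unfold U. rewrite <- circle_pt_period, !sin_2PI_INR, !cos_2PI_INR, !Rmult_0_r.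
    now rewrite sin_0, cos_0.
  - intros s. unfold V. rewrite <- circle_pt_period, !sin_2PI_INR, !cos_2PI_INR, !Rmult_0_r.
    now rewrite sin_0, cos_0.
  - now rewrite E1, E2.
Qed.

(** Read off on the circle of radius [1/2]; by [fcoef_on_circle] any radius in [(0, 1)]
    gives the same value. *)
Definition taylor (F : C -> C) (n : nat) : C :=
  (RtoC (2 ^ n) * fcoef (on_circle F (/ 2)) n)%C.

Lemma exp_minus_INR_ln (n : nat) (r : R) : 0 < r -> exp (- INR n * ln r) = / r ^ n.
Proof.
  intros Hr. rewrite Ropp_mult_distr_l_reverse, exp_Ropp.
  f_equal. exact (Rpower_pow n r Hr).
Qed.

Lemma fcoef_on_circle (F : C -> C) (r : R) (n : nat) : diff_on_disk F -> 0 < r < 1 ->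
  fcoef (on_circle F r) n = (RtoC (r ^ n) * taylor F n)%C.
Proof.
  intros HF Hr.
  assert (L : forall u, 0 < u < 1 -> ln u < 0).
  { intros u Hu. rewrite <- ln_1. apply ln_increasing; lra. }
  assert (E : forall u v, 0 < u < 1 -> 0 < v < 1 ->
    (RtoC (/ u ^ n) * fcoef (on_circle F u) n)%C
    = (RtoC (/ v ^ n) * fcoef (on_circle F v) n)%C).
  { assert (E1 : forall u v, 0 < u < 1 -> 0 < v < 1 -> u <= v ->
      (RtoC (/ u ^ n) * fcoef (on_circle F u) n)%C
      = (RtoC (/ v ^ n) * fcoef (on_circle F v) n)%C).
    { intros u v Hu Hv Huv.
      rewrite <- (exp_minus_INR_ln n u), <- (exp_minus_INR_ln n v) by lra.
      pose proof (fcoef_on_circle_scaled F n (ln u) (ln v) HF) as S.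
      rewrite !exp_ln in S by lra. apply S; auto.
      destruct Huv as [Huv | ->]; [left; apply ln_increasing; lra | lra]. }
    intros u v Hu Hv. destruct (Rle_dec u v); [now apply E1 | symmetry; apply E1; auto; lra]. }
  unfold taylor.
  replace (2 ^ n) with (/ (/ 2) ^ n).
  2: { rewrite pow_inv, Rinv_inv. reflexivity. }
  rewrite <- (E r (/ 2)) by lra.
  rewrite Cmult_assoc, <- RtoC_mult, Rinv_r by (apply pow_nonzero; lra). ring.
Qed.

(** The Bessel inequality on the circle of radius [r], as [r] tends to [1]. *)
Lemma taylor_l2_le (F : C -> C) (A : R) : diff_on_disk F -> 0 <= A ->
  (forall r, 0 < r < 1 -> mean (fun t => Cmod (on_circle F r t) ^ 2) <= A ^ 2) ->
  l2_le (taylor F) A.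
Proof.
  intros HF HA H. split; auto. intros N.
  set (rr := fun m : nat => 1 - / (INR m + 2)).
  assert (Hrr : forall m, 0 < rr m < 1).
  { intros m. unfold rr. pose proof (pos_INR m).
    assert (0 < / (INR m + 2)) by (apply Rinv_0_lt_compat; lra).
    assert (/ (INR m + 2) <= / 2) by (apply Rinv_le_contravar; lra). lra. }
  assert (Hl : is_lim_seq rr 1).
  { replace (Finite 1) with (Finite (1 - 0)) by (f_equal; ring).
    apply is_lim_seq_minus'; [apply is_lim_seq_const|].
    apply is_lim_seq_ext with (fun m => / (INR (S m) + 1)).
    { intros m. rewrite S_INR. f_equal. ring. }
    apply (is_lim_seq_incr_1 (fun m => / (INR m + 1))), is_lim_seq_inv_S. }
  assert (LL : Rbar_le (rsum (fun k => Cmod (taylor F k) ^ 2) N) (A ^ 2)).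
  { apply is_lim_seq_le with
      (fun m => rsum (fun k => (rr m ^ k * rr m ^ k) * Cmod (taylor F k) ^ 2) N)
      (fun _ => A ^ 2).
    - intros m. apply Rle_trans with (2 := H (rr m) (Hrr m)).
      apply Rle_trans with (2 := bessel _ N
        (tcont_on_circle F (rr m) HF (conj (Rlt_le _ _ (proj1 (Hrr m))) (proj2 (Hrr m))))).
      apply rsum_le. intros k _. rewrite fcoef_on_circle by auto.
      rewrite Cmod_mult, Cmod_R. right.
      rewrite Rabs_pos_eq by (apply pow_le; left; apply Hrr). ring.
    - clear H. induction N; cbn [rsum]; [apply is_lim_seq_const|].
      apply is_lim_seq_plus'; auto.
      assert (Hp : is_lim_seq (fun m => rr m ^ N) 1).
      { clear IHN. induction N; simpl; [apply is_lim_seq_const|].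
        replace (Finite 1) with (Finite (1 * 1)) by (f_equal; ring).
        now apply is_lim_seq_mult'. }
      replace (Cmod (taylor F N) ^ 2) with (1 * 1 * Cmod (taylor F N) ^ 2) at 1 by ring.
      apply is_lim_seq_mult'; [now apply is_lim_seq_mult' | apply is_lim_seq_const].
    - apply is_lim_seq_const. }
  exact LL.
Qed.

Lemma taylor_lin (F G : C -> C) (a : C) (n : nat) : diff_on_disk F -> diff_on_disk G ->
  taylor (fun z => F z + a * G z)%C n = (taylor F n + a * taylor G n)%C.
Proof.
  intros HF HG. unfold taylor, fcoef.
  assert (CF : tcont (on_circle F (/ 2))) by (apply tcont_on_circle; auto; lra).
  assert (CG : tcont (on_circle G (/ 2))) by (apply tcont_on_circle; auto; lra).
  rewrite (cmean_ext _ (fun t => on_circle F (/ 2) t * Cconj (chr n t)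
     + a * (on_circle G (/ 2) t * Cconj (chr n t)))%C).
  2: { intros t. unfold on_circle. ring. }
  rewrite cmean_plus, cmean_scal.
  - ring.
  - now apply tcont_mult_chr.
  - now apply tcont_mult_chr.
  - now apply tcont_scal, tcont_mult_chr.
Qed.

Lemma taylor_ext (F G : C -> C) (n : nat) : (forall z, Cmod z < 1 -> F z = G z) ->
  taylor F n = taylor G n.
Proof.
  intros H. unfold taylor, fcoef. f_equal. apply cmean_ext. intros t. unfold on_circle.
  rewrite H; auto. rewrite Cmod_circle_pt; lra.
Qed.

(** * Taylor coefficients and means of power series *)

Lemma circle_pt_pow (r t : R) (n : nat) :
  ((circle_pt r t) ^ n)%C = (RtoC (r ^ n) * chr n t)%C.
Proof.
  induction n.
  - unfold chr. simpl. rewrite Rmult_0_l, cos_0, sin_0. apply C_ext; simpl; ring.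
  - rewrite Cpow_S, IHn. unfold circle_pt, chr. rewrite S_INR.
    replace ((INR n + 1) * t) with (INR n * t + t) by ring.
    rewrite cos_plus, sin_plus. apply C_ext; simpl; ring.
Qed.

Lemma psum_on_circle_tail (y : nat -> C) (M r t : R) (N : nat) :
  (forall n, Cmod (y n) <= M) -> 0 <= r < 1 ->
  Cmod (on_circle (psum y) r t - tpoly (fun k => y k * RtoC (r ^ k))%C N t)%C
    <= M * / (1 - r) * r ^ N.
Proof.
  intros HM Hr.
  replace (tpoly (fun k => y k * RtoC (r ^ k))%C N t)
    with (csum (fun n => y n * (circle_pt r t) ^ n)%C N).
  - apply psum_tail; auto; try lra. rewrite Cmod_circle_pt; lra.
  - apply csum_ext. intros k _. rewrite circle_pt_pow. ring.
Qed.

Lemma psum_tail_lim (M r : R) : 0 <= r < 1 ->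
  is_lim_seq (fun N => M * / (1 - r) * r ^ N) 0.
Proof.
  intros Hr. replace (Finite 0) with (Rbar_mult (M * / (1 - r)) 0)
    by (simpl; f_equal; ring).
  apply is_lim_seq_scal_l, is_lim_seq_geom. rewrite Rabs_pos_eq; lra.
Qed.

Lemma diff_psum (y : nat -> C) (M : R) : (forall n, Cmod (y n) <= M) -> diff_on_disk (psum y).
Proof. intros HM z Hz. now apply psum_cdiff with M. Qed.

Lemma taylor_psum (y : nat -> C) (M : R) (n : nat) :
  (forall n, Cmod (y n) <= M) -> taylor (psum y) n = y n.
Proof.
  intros HM. unfold taylor.
  rewrite (fcoef_of_uniform_series (on_circle (psum y) (/ 2))
    (fun k => y k * RtoC ((/ 2) ^ k))%C (fun N => M * / (1 - / 2) * (/ 2) ^ N)).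
  - rewrite (Cmult_comm (y n)), Cmult_assoc, <- RtoC_mult, <- Rpow_mult_distr.
    replace (2 * / 2) with 1 by field. rewrite pow1. ring.
  - apply tcont_on_circle; [now apply diff_psum with M | lra].
  - apply psum_tail_lim; lra.
  - intros N t. apply psum_on_circle_tail; auto; lra.
Qed.

Lemma mean_psum_le (y : nat -> C) (A r : R) : l2_le y A -> 0 <= r < 1 ->
  mean (fun t => Cmod (on_circle (psum y) r t) ^ 2) <= A ^ 2.
Proof.
  intros Hy Hr.
  assert (HM : forall n, Cmod (y n) <= A) by (intros; now apply l2_le_term).
  apply mean_le_of_uniform_series with (fun k => y k * RtoC (r ^ k))%C
    (fun N => A * / (1 - r) * r ^ N).
  - apply tcont_on_circle; [now apply diff_psum with A | lra].
  - now apply psum_tail_lim.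
  - intros N t. now apply psum_on_circle_tail.
  - destruct Hy as [HA Hy]. split; auto. intros n. apply Rle_trans with (2 := Hy n).
    apply rsum_le. intros k _. rewrite Cmod_mult, Cmod_R.
    assert (0 <= r ^ k <= 1).
    { split; [apply pow_le; lra|]. rewrite <- (pow1 k). apply pow_incr; lra. }
    rewrite Rabs_pos_eq by lra. pose proof (Cmod_ge_0 (y k)).
    apply pow_incr. nra.
Qed.

(** * The Hardy space and little l-two *)

Lemma extend_psum (y : nat -> C) (u : C) : Cmod u < 1 ->
  extend (fun z : disk => psum y z) u = psum y u.
Proof. intros Hu. unfold extend. destruct (Rlt_dec (Cmod u) 1); [reflexivity | lra]. Qed.

Lemma analytic_diff_on_disk (g : disk -> C) : analytic g -> diff_on_disk (extend g).
Proof.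
  intros Hg z Hz. apply ex_derive_cdiff. exact (Hg (exist _ z Hz)).
Qed.

Lemma mean_le_H2_norm (g : disk -> C) (r : R) : H2 g -> 0 < r < 1 ->
  mean (fun t => Cmod (on_circle (extend g) r t) ^ 2) <= H2_norm g ^ 2.
Proof.
  intros [Ha Hf] Hr.
  assert (Hub : forall q, 0 < q < 1 -> circle_mean g q <= real (H2_norm_sq g)).
  { intros q Hq.
    assert (Rbar_le (circle_mean g q) (H2_norm_sq g)) as HH.
    { apply (proj1 (Lub_Rbar_correct _)). now exists q. }
    rewrite <- Hf in HH. exact HH. }
  unfold H2_norm. rewrite pow2_sqrt.
  - exact (Hub r Hr).
  - apply Rle_trans with (2 := Hub r Hr).
    apply (mean_Cmod2_nonneg (on_circle (extend g) r)).
    apply tcont_on_circle; [now apply analytic_diff_on_disk | lra].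
Qed.

Lemma taylor_H2 (g : disk -> C) : H2 g -> l2_le (taylor (extend g)) (H2_norm g).
Proof.
  intros Hg. apply taylor_l2_le.
  - apply analytic_diff_on_disk, Hg.
  - apply sqrt_pos.
  - intros r Hr. now apply mean_le_H2_norm.
Qed.

(** The other half of the identification of the Hardy space with little l-two: every
    square-summable sequence is the coefficient sequence of a Hardy function. *)
Lemma psum_H2 (y : nat -> C) (A : R) : l2_le y A ->
  H2 (fun z : disk => psum y z) /\ H2_norm (fun z : disk => psum y z) <= A.
Proof.
  intros Hy. set (g := fun z : disk => psum y z).
  assert (HM : forall n, Cmod (y n) <= A) by (intros; now apply l2_le_term).
  assert (Ha : analytic g).
  { intros z. apply ex_derive_cdiff.
    destruct (psum_cdiff y A z HM (disk_lt z)) as [l Hl]. exists l.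
    apply cdiff_ext_disk with (3 := Hl); [apply disk_lt|].
    intros u Hu. symmetry. now apply extend_psum. }
  assert (Hc : forall r, 0 < r < 1 -> 0 <= circle_mean g r <= A ^ 2).
  { intros r Hr.
    assert (E : circle_mean g r = mean (fun t => Cmod (on_circle (psum y) r t) ^ 2)).
    { apply mean_ext. intros t. unfold on_circle. do 2 f_equal.
      apply extend_psum. rewrite Cmod_circle_pt; lra. }
    rewrite E. split.
    - apply mean_Cmod2_nonneg, tcont_on_circle; [now apply diff_psum with A | lra].
    - apply mean_psum_le; auto; lra. }
  assert (Hlub : Rbar_le (H2_norm_sq g) (A ^ 2)).
  { apply (proj2 (Lub_Rbar_correct _)). intros v [r [Hr ->]]. apply (Hc r Hr). }
  assert (Hhalf : 0 < / 2 < 1) by lra.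
  assert (Hlow : Rbar_le 0 (H2_norm_sq g)).
  { apply Rbar_le_trans with (circle_mean g (/ 2)); [apply (Hc _ Hhalf)|].
    apply (proj1 (Lub_Rbar_correct _)). now exists (/ 2). }
  assert (Hfin : is_finite (H2_norm_sq g)).
  { destruct (H2_norm_sq g); simpl in *; try contradiction; reflexivity. }
  split; [now split|].
  unfold H2_norm. rewrite <- Hfin in Hlub. simpl in Hlub.
  destruct Hy as [HA _].
  rewrite <- (sqrt_pow2 A HA). apply sqrt_le_1_alt. exact Hlub.
Qed.

Lemma taylor_fadd (g h : disk -> C) (n : nat) : analytic g -> analytic h ->
  taylor (extend (fadd g h)) n = (taylor (extend g) n + taylor (extend h) n)%C.
Proof.
  intros Hg Hh.
  rewrite (taylor_ext _ (fun z => extend g z + 1 * extend h z)%C).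
  - rewrite taylor_lin by now apply analytic_diff_on_disk. ring.
  - intros z Hz. unfold extend, fadd. destruct (Rlt_dec (Cmod z) 1); [ring | lra].
Qed.

Lemma taylor_fscal (a : C) (g : disk -> C) (n : nat) : analytic g ->
  taylor (extend (fscal a g)) n = (a * taylor (extend g) n)%C.
Proof.
  intros Hg.
  (* Written as [g + (a - 1) g], scaling is an instance of [taylor_lin]. *)
  rewrite (taylor_ext _ (fun z => extend g z + (a - 1) * extend g z)%C).
  - rewrite taylor_lin by now apply analytic_diff_on_disk. ring.
  - intros z Hz. unfold extend, fscal. destruct (Rlt_dec (Cmod z) 1); [ring | lra].
Qed.

Lemma taylor_szego (w : disk) (n : nat) : taylor (extend (szego w)) n = (Cconj w ^ n)%C.
Proof.
  assert (Hw : Cmod (Cconj w) < 1) by (rewrite Cmod_conj; apply disk_lt).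
  rewrite (taylor_ext _ (psum (fun k => 1 * Cconj w ^ k)%C)).
  - rewrite (taylor_psum _ 1); [ring|].
    intros k. rewrite Cmod_mult, Cmod_1, Cmod_pow, Rmult_1_l.
    rewrite <- (pow1 k). apply pow_incr. split; [apply Cmod_ge_0 | lra].
  - intros z Hz. rewrite psum_geom by auto. unfold extend, szego.
    destruct (Rlt_dec (Cmod z) 1); [reflexivity | lra].
Qed.

(** * The operator *)

Lemma image_ext (phi psi : disk -> C) (x x' y : nat -> C) :
  (forall n, x n = x' n) -> image phi psi x y -> image phi psi x' y.
Proof.
  intros E H eps Heps. destruct (H eps Heps) as [L [H1 H2]]. exists L. split; auto.
  apply l2_le_ext with (2 := H1). intros n; now rewrite E.
Qed.

Lemma image_kernel (phi psi : disk -> C) (w : disk) :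
  image phi psi (fun n => Cconj w ^ n)%C (fun n => Cconj (phi w) * Cconj (psi w) ^ n)%C.
Proof.
  intros eps Heps. exists ((RtoC 1, w) :: nil).
  split; apply l2_le_zero; try lra; intros n; unfold kcoef, unit_symbol; simpl lsum.
  - rewrite Cconj_1. ring.
  - ring.
Qed.

Definition image_of (phi psi : disk -> C) (x : nat -> C) : nat -> C :=
  epsilon (inhabits x) (image phi psi x).

(** The operator [C_psi^* T_phi^*]: pass to Taylor coefficients, apply the closure
    of the densely defined operator, and sum the resulting power series. *)
Definition weighted_comp_adjoint (phi psi : disk -> C) (g : disk -> C) (z : disk) : C :=
  psum (image_of phi psi (taylor (extend g))) z.

Lemma image_of_spec (phi psi : disk -> C) (B : R) (g : disk -> C) :
  contractive_on_kernels phi psi B -> H2 g ->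
  image phi psi (taylor (extend g)) (image_of phi psi (taylor (extend g))).
Proof.
  intros HB Hg. unfold image_of. apply epsilon_spec.
  apply image_exists with (1 := HB) (2 := taylor_H2 g Hg).
Qed.

Lemma image_of_le (phi psi : disk -> C) (B : R) (g : disk -> C) :
  contractive_on_kernels phi psi B -> H2 g ->
  l2_le (image_of phi psi (taylor (extend g))) (B * H2_norm g).
Proof.
  intros HB Hg. apply image_le with (1 := HB) (2 := image_of_spec _ _ _ _ HB Hg).
  now apply taylor_H2.
Qed.

Lemma image_of_unique (phi psi : disk -> C) (B : R) (x y : nat -> C) :
  contractive_on_kernels phi psi B -> image phi psi x y ->
  forall n, image_of phi psi x n = y n.
Proof.
  intros HB Hxy. apply image_unique with (1 := HB) (3 := Hxy).
  unfold image_of. apply epsilon_spec. now exists y.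
Qed.

Lemma weighted_comp_adjoint_H2 (phi psi : disk -> C) (B : R) (g : disk -> C) :
  contractive_on_kernels phi psi B -> H2 g ->
  H2 (weighted_comp_adjoint phi psi g) /\
  H2_norm (weighted_comp_adjoint phi psi g) <= B * H2_norm g.
Proof. intros HB Hg. apply psum_H2. now apply image_of_le. Qed.

Lemma weighted_comp_adjoint_add (phi psi : disk -> C) (B : R) (g h : disk -> C) (z : disk) :
  contractive_on_kernels phi psi B -> H2 g -> H2 h ->
  weighted_comp_adjoint phi psi (fadd g h) z =
  fadd (weighted_comp_adjoint phi psi g) (weighted_comp_adjoint phi psi h) z.
Proof.
  intros HB Hg Hh. unfold weighted_comp_adjoint, fadd at 2.
  rewrite (psum_ext _ (fun n => image_of phi psi (taylor (extend g)) n
             + 1 * image_of phi psi (taylor (extend h)) n)%C).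
  - rewrite (psum_lin _ _ _ (B * H2_norm g) (B * H2_norm h)).
    + ring.
    + intros n. apply l2_le_term. now apply image_of_le.
    + intros n. apply l2_le_term. now apply image_of_le.
    + apply disk_lt.
  - intros n. rewrite Cmult_1_l. revert n. apply image_of_unique with (1 := HB).
    apply image_ext with (2 := image_plus _ _ _ _ _ _
      (image_of_spec _ _ _ _ HB Hg) (image_of_spec _ _ _ _ HB Hh)).
    intros n. symmetry. apply taylor_fadd; [apply Hg | apply Hh].
Qed.

Lemma weighted_comp_adjoint_scal (phi psi : disk -> C) (B : R) (a : C) (g : disk -> C)
  (z : disk) : contractive_on_kernels phi psi B -> H2 g ->
  weighted_comp_adjoint phi psi (fscal a g) z =
  fscal a (weighted_comp_adjoint phi psi g) z.
Proof.
  intros HB Hg. unfold weighted_comp_adjoint, fscal at 2.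
  (* As in [taylor_fscal], [a y] is written as [y + (a - 1) y]. *)
  set (y := image_of phi psi (taylor (extend g))).
  assert (Hy : forall n, Cmod (y n) <= B * H2_norm g).
  { intros n. apply l2_le_term. now apply image_of_le. }
  rewrite (psum_ext _ (fun n => y n + (a - 1) * y n)%C).
  - rewrite (psum_lin _ _ _ _ _ _ Hy Hy) by apply disk_lt. ring.
  - intros n. replace (y n + (a - 1) * y n)%C with (a * y n)%C by ring.
    revert n. apply image_of_unique with (1 := HB).
    apply image_ext with (2 := image_scal _ _ a _ _ (image_of_spec _ _ _ _ HB Hg)).
    intros n. symmetry. apply taylor_fscal, Hg.
Qed.

Lemma weighted_comp_adjoint_szego (phi psi : disk -> C) (B : R) (w z : disk) :
  contractive_on_kernels phi psi B -> Cmod (psi w) < 1 ->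
  weighted_comp_adjoint phi psi (szego w) z = (Cconj (phi w) * szego (psi w) z)%C.
Proof.
  intros HB Hpsi. unfold weighted_comp_adjoint.
  assert (Hc : Cmod (Cconj (psi w)) < 1) by now rewrite Cmod_conj.
  rewrite (psum_ext _ (fun n => Cconj (phi w) * Cconj (psi w) ^ n)%C).
  - rewrite psum_geom by (auto using disk_lt). unfold szego. field.
    apply one_minus_neq_0, Cmod_mult_lt_1; auto using disk_lt.
  - apply image_of_unique with (1 := HB).
    apply image_ext with (2 := image_kernel phi psi w).
    intros n. symmetry. apply taylor_szego.
Qed.

Theorem theorem0p1 (b : disk -> C)
    (hb : Hinf b)
    (hb_nonconst : ~ exists c : C, forall z : disk, b z = c)
    (hb_norm : Rbar_le (sup_norm b) (Finite 1))
    (Hb : hilbert_function_space disk)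
    (hHb : is_de_Branges_Rovnyak b Hb)
    (f : disk -> C)
    (hf : hfs_mem Hb f) :
  exists T : (disk -> C) -> (disk -> C),
    H2_bounded_operator T /\
    (forall w z : disk,
       T (szego w) z = Cmult (Cconj (f w)) (szego (b w) z)) /\
    Rbar_le (H2_op_norm T) (Finite (hfs_norm Hb f)).
Proof.
  set (B := hfs_norm Hb f).
  assert (HB : contractive_on_kernels f b B).
  { split; [apply sqrt_pos|]. intros L A. now apply kcoef_bound. }
  exists (weighted_comp_adjoint f b). repeat split.
  - now apply (weighted_comp_adjoint_H2 f b B g HB).
  - now apply (weighted_comp_adjoint_H2 f b B g HB).
  - intros g h Hg Hh z. now apply weighted_comp_adjoint_add with B.
  - intros a g Hg z. now apply weighted_comp_adjoint_scal with B.
  - exists B. intros g Hg. now apply weighted_comp_adjoint_H2.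
  - intros w z. apply weighted_comp_adjoint_szego with B; auto.
    now apply dBR_symbol_lt_1 with Hb.
  - apply (proj2 (Lub_Rbar_correct _)). intros v (g & Hg & Hg1 & ->). simpl.
    destruct (weighted_comp_adjoint_H2 f b B g HB Hg) as [_ Hle].
    destruct HB as [HB0 _]. apply Rle_trans with (1 := Hle). nra.
Qed.
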